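(* Let $(r_n)$ be a sequence of positive integers with $r_n\to\infty$ and let $(t_n)$ be a sequence of nonnegative integers. Assume that the fractional parts $\{-\log_q(r_n)\}$ converge to $\zeta$ as $n\to\infty$, and let $\mathcal{L}=\mathcal{L}_{1,q^{-1},q^{-1-\zeta}}$. (1) Assume that $t_n=t$ for a nonnegative constant $t$. Let $D$ be a random variable independent from $\mathcal{L}$ such that $D$ has the same distribution as $\dim\ker L_t$. Then, as $n\to\infty$, $\beta^{r_n,r_n+t}-\lfloor \log_q(r_n)+\zeta\rceil$ converges in distribution to $\mathcal{L}-D$. (2) Assume that $t_n\to\infty$ and $\log_q(t_n)-\log_q(r_n)\to-\infty$. Moreover, assume that the fractional parts $\{-\log_q(t_n)\}$ converge to $\zeta'$. Let $\mathcal{L}'=\mathcal{L}_{1,q^{-1},q^{-1-\zeta'}}$ be independent from $\mathcal{L}$. Then, as $n\to\infty$, $\beta^{r_n,r_n+t_n}-(\lfloor \log_q(r_n)+\zeta\rceil-\lfloor \log_q(t_n)+\zeta'\rceil)$ converges in distribution to $\mathcal{L}-\mathcal{L}'$. (3) Assume that $\log_q(t_n)-\log_q(r_n)\to\gamma\in\mathbb{R}$. Let $\zeta'=\{\zeta-\gamma\}$ (fractional part). Let $\mathcal{L}'=\mathcal{L}_{1,q^{-1},q^{-1-\zeta'}}$ be independent from $\mathcal{L}$. Let $\mathcal{J}=\gamma+\zeta'-\zeta+\mathcal{L}'-\mathcal{L}$ (which is integer valued). Then $\beta^{r_n,r_n+t_n}$ converges in distribution to $\max(0,-\mathcal{J})+J_{|\mathcal{J}|}$,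 where $J_0,J_1,\dots$ are independent from $\mathcal{J}$. (4) Assume that $\log_q(t_n)-\log_q(r_n)\to\infty$. Then $\lim_{n\to\infty}\mathbb{P}(\beta^{r_n,r_n+t_n}=0)=1$.
   Context: Setting. Fix a prime power $q$. Let $(L(i,j))_{1\le j\le i}$ ($i,j\in\mathbb{Z}_+=\{1,2,\dots\}$) be i.i.d. uniform random elements of $\mathbb{F}_q$, and let $L(i,j)=0$ for $1\le i<j$; $L=(L(i,j))_{i,j\in\mathbb{Z}_+}$, and $L_n=(L(i,j))_{1\le i,j\le n}$ is its top left $n\times n$ submatrix ($L_0$ is the empty matrix, with $\dim\ker L_0=0$). Let $\mathbb{F}_q^{\mathbb{Z}_+}$ denote the space of row vectors indexed by $\mathbb{Z}_+$ with only finitely many nonzero components. Let $Z_n=\{v\in\mathbb{F}_q^{\mathbb{Z}_+} : v_i=0\text{ for all }i>n\}$ and let $B_n=\{vL : v\in Z_n\}$ be the span of the first $n$ rows of $L$. The persistent Betti numbers are \[\beta^{r,s}=\dim\frac{Z_r}{Z_r\cap B_s}.\] Notation. For $x\in\mathbb{R}$, $\{x\}$ denotes the fractional part and $\lfloor x\rceil=\lfloor x+0.5\rfloor$. For an integer $u\ge 0$, $J_u$ is a $\mathbb{Z}_{\ge 0}$-valued random variable with \[\mathbb{P}(J_u=k)=q^{-k(k+u)}\prod_{i=1}^k(1-q^{-i})^{-1}\prod_{i=1}^{k+u}(1-q^{-i})^{-1}\prod_{i=1}^\infty(1-q^{-i}).\] For $\chi>0$, $\mathcal{L}_{1,q^{-1},\chi}$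 is a $\mathbb{Z}$-valued random variable such that for all $x\in\mathbb{Z}$, \[\mathbb{P}(\mathcal{L}_{1,q^{-1},\chi}=x)=\frac{1}{\prod_{i=1}^{\infty}(1-q^{-i})}\sum_{m=0}^\infty \exp(-\chi q^{m-x})\frac{(-1)^m q^{-\binom{m}{2}}}{\prod_{j=1}^m(1-q^{-j})}.\] *)

(* Defs.v *)
From HB Require Import structures.
From mathcomp Require Import all_boot all_order all_algebra finmap.
From mathcomp Require Import all_classical all_reals all_analysis.

Set Implicit Arguments.
Unset Strict Implicit.
Unset Printing Implicit Defensive.
Import Order.TTheory GRing.Theory Num.Theory.
Import numFieldNormedType.Exports.
Local Open Scope classical_set_scope.
Local Open Scope ring_scope.

Section QuotientDimension.
Variables (K : fieldType) (V : lmodType K).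
Implicit Types U W : set V.

(* For a subspace [W] of a subspace [U]: the cosets of [b 0, ..., b (d - 1)]
   form a basis of [U / W]. *)
Definition basis_mod U W (d : nat) (b : 'I_d -> V) : Prop :=
  (forall i, U (b i)) /\
  forall v, U v -> exists! c : 'rV[K]_d, W (v - \sum_(i < d) c 0 i *: b i).

(* [dim (U / W)], with junk value 0 if [U / W] is infinite dimensional. *)
Definition dim_quotient U W : nat :=
  xget 0%N [set d | exists b : 'I_d -> V, basis_mod U W b].

End QuotientDimension.

(* Rows and columns are indexed from 0: [L i j] is the entry in row [i + 1] and
   column [j + 1]. *)
Section PersistentBetti.
Variables (F : fieldType) (L : nat -> nat -> F).

Definition Z_ (n : nat) : set (nat -> F^o) :=
  [set v | forall i, (n <= i)%N -> v i = 0].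

Definition vecmat_mul (v : nat -> F^o) : nat -> F^o :=
  fun j => \sum_(i \in [set: nat]) (v i * L i j : F).

Lemma vecmat_mulE n v j :
  Z_ n v -> vecmat_mul v j = \sum_(i < n) v i * L i j.
Proof.
move=> vn; rewrite /vecmat_mul -(fsbig_widen `I_n) //=; last first.
  by move=> i [_ /= /negP]; rewrite -leqNgt => ni; rewrite vn //; exact: mul0r.
by rewrite -(fsbig_ord +%R n (fun i => (v i : F) * L i j)).
Qed.

Definition B_ (n : nat) : set (nat -> F^o) := vecmat_mul @` Z_ n.

Definition persistent_betti (r s : nat) : nat :=
  dim_quotient (Z_ r) (Z_ r `&` B_ s).

Definition corner (n : nat) : 'M[F]_n := \matrix_(i, j) L i j.

Definition dim_ker_corner (n : nat) : nat := \rank (kermx (corner n)).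

End PersistentBetti.

Section Probability.
Context d (T : measurableType d) (R : realType) (P : probability T R).

(* Measurability for the discrete sigma-algebra on the (countable) codomain;
   likewise, below, arbitrary subsets of the codomain are events. *)
Definition discrete_rv (S : Type) (X : T -> S) : Prop :=
  forall A : set S, measurable (X @^-1` A).

Definition independent_rv (S S' : Type) (X : T -> S) (Y : T -> S') : Prop :=
  forall (A : set S) (B : set S'),
    P (X @^-1` A `&` Y @^-1` B) = (P (X @^-1` A) * P (Y @^-1` B))%E.

Definition mutually_independent (I : choiceType) (D : set I) (S : Type)
    (X : I -> T -> S) : Prop :=
  forall J : {fset I}, [set` J] `<=` D -> forall A : I -> set S,
    P (\bigcap_(i in [set` J]) (X i @^-1` A i)) =
    (\prod_(i <- J) P (X i @^-1` A i))%E.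

Definition uniform_lower_triangular (F : finFieldType)
    (L : nat -> nat -> T -> F) : Prop :=
  [/\ forall i j, discrete_rv (L i j),
      forall i j w, (i < j)%N -> L i j w = 0,
      forall i j a, (j <= i)%N ->
        P (L i j @^-1` [set a]) = ((#|F|%:R : R)^-1)%:E &
      mutually_independent [set ij : nat * nat | (ij.2 <= ij.1)%N]
        (fun ij => L ij.1 ij.2)].

End Probability.

Definition cvg_in_distribution (R : realType)
    d (T : measurableType d) (P : probability T R) (X : nat -> T -> R)
    d' (T' : measurableType d') (P' : probability T' R) (Y : T' -> R) : Prop :=
  [/\ forall n, measurable_fun setT (X n),
      measurable_fun setT Y &
      forall x : R,
        {for x, continuous (fun y : R => P' [set w | Y w <= y])} ->
        P [set w | X n w <= x] @[n --> \oo] --> P' [set w | Y w <= x]].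

Section Numbers.
Variable R : realType.
Implicit Types (q chi : R).

(* Pitfall: [logb q 0 = 0], whereas mathematically it is -oo. *)
Definition logb q (x : R) : R := ln x / ln q.

Definition frac_part (x : R) : R := x - (Num.floor x)%:~R.

Definition nearest_int (x : R) : int := Num.floor (x + 2^-1).

Definition qprod q (n : nat) : R := \prod_(1 <= i < n.+1) (1 - q ^- i).

Definition qprod_infty q : R := limn (qprod q).

Definition J_pmf q (u k : nat) : R :=
  q ^- (k * (k + u)) * (qprod q k)^-1 * (qprod q (k + u))^-1 * qprod_infty q.

(* The law of [L_(1, q^-1, chi)]. *)
Definition calL_pmf q chi (x : int) : R :=
  (qprod_infty q)^-1 *
  limn (series (fun m : nat => expR (- chi * q ^ (m%:Z - x)) *
                               ((-1) ^+ m * q ^- 'C(m, 2) / qprod q m))).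

Definition has_J_law q (u : nat) d (T : measurableType d)
    (P : probability T R) (X : T -> nat) : Prop :=
  discrete_rv X /\ forall k, P (X @^-1` [set k]) = (J_pmf q u k)%:E.

Definition has_calL_law q chi d (T : measurableType d)
    (P : probability T R) (X : T -> int) : Prop :=
  discrete_rv X /\ forall x, P (X @^-1` [set x]) = (calL_pmf q chi x)%:E.

End Numbers.

(* Main.v *)
(** Write [L_(r + t) = [A, 0; C, D]], where [A] and [D] are independent and
    distributed as [L_r] and [L_t], and [C] is uniform. Then [Z_r] meets [B_(r + t)]
    in the row space of [A] and [ker D * C], so that, given [m = corank A] and
    [k = corank D], [beta^(r, r + t)] is distributed as the corank [m - rank U] of
    a uniform [k * m] matrix [U]. The law [rho] of that corank satisfies a recursion
    in [k], which has a product solution; it concentrates at [m - k] when [m - k] is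
    large and converges to the law of [J] when [m, k -> oo] with [m - k] fixed.

    The corank of [L_n] is a pure birth chain in [n], jumping from [m] to [m + 1]
    with probability [q ^- (m + 1)]. Its law has an exact alternating expression,
    which converges term by term, with domination, to the law of [calL]. All
    pointwise limits have total mass 1, so they imply convergence in distribution.

    When [log t - log r -> +oo], the limits of the fractional parts of [log t] are
    not controlled; there [E q^(corank L_r) = 1 + r (1 - q^-1)] and
    [E q^(- corank L_t) = O (1 / t)] bound [P (beta <> 0) <= E q^(m - k)]. *)

(* The corank laws themselves do not converge: their bulk drifts like [log r] and [log t]. They are
   read in integer coordinates [m = a n + i], [k = b n + j] with [i] and [j] fixed, where
   [a n - log r] and [b n - log t] converge; this is what convergence of the fractional parts
   provides, and why the laws are extended to all integers ([imass], [irho]). No uniformity in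
   [(i, j)] is needed afterwards: a finite list of pairs carries almost all the limit mass, and
   lower bounds for an event and for its complement on that list give both inequalities.
   Expectations over the birth chain are encoded as a recursion on the test function, so a moment
   estimate is an identity for the one-step drift: [q ^+ m] gains a constant on average, and
   [q ^- m] loses a multiple of its square, a discrete Riccati equation that yields the decay in
   [1 / t]. The bound [2 <= q] supplies the absolute constants in the dominations. *)
Require Import Defs.
From mathcomp Require Import finmap.
From mathcomp Require Import all_boot all_order all_algebra mxabelem ring lra zify.
From mathcomp Require Import all_classical all_reals all_analysis.

Set Implicit Arguments.
Unset Strict Implicit.
Unset Printing Implicit Defensive.
Import Order.TTheory GRing.Theory Num.Theory.
Import numFieldNormedType.Exports.
Local Open Scope classical_set_scope.
Local Open Scope ring_scope.

(** * Counting matrices by rank *)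

(* [rho q k m b] is the probability that a uniform [k * m] matrix has rank
   [m - b]; each new row lies in the span of the others with probability
   [q ^- (m - rank)]. *)
Fixpoint rho (R : realFieldType) (q : R) (k m b : nat) : R :=
  if k is k'.+1 then q ^- m * rho q k' m b + (1 - q ^- m) * rho q k' m.-1 b
  else (m == b)%:R.

(* [corank_mean q n psi] is the expectation of [psi] at the corank of a uniform
   lower triangular [n * n] matrix: adding a row and a column raises the corank
   from [m] to [m + 1] with probability [q ^- (m + 1)]. *)
Fixpoint corank_mean (R : realFieldType) (q : R) (n : nat) (psi : nat -> R) : R :=
  if n is n'.+1 then
    corank_mean q n'
      (fun m => q ^- m.+1 * psi m.+1 + (1 - q ^- m.+1) * psi m)
  else psi 0%N.

Definition corank (F : fieldType) (n p : nat) (A : 'M[F]_(p, n)) : nat :=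
  (n - \rank A)%N.

Section Counting.
Variables (F : finFieldType) (R : realFieldType).
Notation q := (#|F|%:R : R).

Lemma card_field_gt1 : (1 < #|F|)%N.
Proof. by rewrite (cardD1 0) inE (cardD1 1) !inE oner_eq0. Qed.

Lemma card_field_gt0R : 0 < q.
Proof. by rewrite ltr0n ltnW // card_field_gt1. Qed.

Lemma rank_adds_row (n p : nat) (A : 'M[F]_(p, n)) (c : 'rV[F]_n) :
  \rank (A + c)%MS = (\rank A + ~~ (c <= A)%MS)%N.
Proof.
have [cA|cA] := boolP (c <= A)%MS.
  by rewrite addn0; apply: eqmx_rank; apply/eqmxP/addsmx_idPl.
apply/eqP; rewrite eqn_leq; apply/andP; split.
  by rewrite (leq_trans (mxrank_adds_leqif _ _)) // leq_add2l rank_leq_row.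
rewrite addn1 ltnNge; apply: contra cA => h.
apply: submx_trans (addsmxSr A c) _.
by rewrite -(mxrank_leqif_sup (addsmxSl A c)) eqn_leq h mxrankS ?addsmxSl.
Qed.

(** Exactly [q ^+ \rank A] of the [q ^+ n] rows lie in the row space of [A]; the others raise the
    rank by one. *)
Lemma sum_rank_adds_row (n p : nat) (A : 'M[F]_(p, n)) (g : nat -> R) :
  \sum_(c : 'rV[F]_n) g (\rank (A + c)%MS) =
  q ^+ \rank A * g (\rank A) + (q ^+ n - q ^+ \rank A) * g (\rank A).+1.
Proof.
have cardA : #|[pred c : 'rV[F]_n | (c <= A)%MS]| = (#|F| ^ \rank A)%N.
  by rewrite -card_rowg; apply: eq_card => c; rewrite mem_rowg.
rewrite (bigID (fun c : 'rV[F]_n => (c <= A)%MS)) /=; congr (_ + _).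
  rewrite (eq_bigr (fun=> g (\rank A))); last first.
    by move=> c cA; rewrite rank_adds_row cA addn0.
  by rewrite sumr_const cardA -natrX mulr_natl.
rewrite (eq_bigr (fun=> g (\rank A).+1)); last first.
  by move=> c cA; rewrite rank_adds_row cA addn1.
rewrite sumr_const -!natrX -natrB ?leq_exp2l ?card_field_gt1 ?rank_leq_col //.
rewrite mulr_natl; congr (_ *+ _).
have := cardC [pred c : 'rV[F]_n | (c <= A)%MS].
by rewrite cardA card_mx mul1n => <-; rewrite addKn; apply: eq_card.
Qed.

Lemma sum_col_mx (m1 m2 n : nat) (f : 'M[F]_(m1 + m2, n) -> R) :
  \sum_C f C = \sum_C1 \sum_C2 f (col_mx C1 C2).
Proof.
rewrite pair_big /=.
rewrite (reindex (fun C : 'M[F]_(m1, n) * 'M[F]_(m2, n) => col_mx C.1 C.2)) //.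
exists (fun C => (usubmx C, dsubmx C)) => [[C1 C2] _ /=|C _ /=].
  by rewrite col_mxKu col_mxKd.
exact: vsubmxK.
Qed.

Lemma eqmx_corank (n p p' : nat) (A : 'M[F]_(p, n)) (B : 'M[F]_(p', n)) :
  (A :=: B)%MS -> corank A = corank B.
Proof. by move=> AB; rewrite /corank AB. Qed.

(** The induction absorbs the first row of [C] into [A], which is why [A] is arbitrary: the corank
    is kept with probability [q ^- corank A] and drops by one otherwise, as in the recursion of
    [rho]. *)
Lemma sum_corank_adds (n k p b : nat) (A : 'M[F]_(p, n)) :
  \sum_(C : 'M[F]_(k, n)) (corank (A + C)%MS == b)%:R =
  q ^+ (k * n) * rho q k (corank A) b.
Proof.
elim: k p A => [|k IH] p A /=.
  rewrite (big_pred1 (const_mx 0)) => [|C]; last first.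
    by rewrite /= flatmx0; apply/esym/eqP; exact: flatmx0.
  by rewrite mul0n expr0 mul1r (eqmx_corank (addsmx0 _ _)).
rewrite -add1n sum_col_mx.
have E (c : 'rV[F]_n) : \sum_(C : 'M[F]_(k, n))
      (corank (A + col_mx c C)%MS == b)%:R =
    q ^+ (k * n) * rho q k (corank (A + c)%MS) b.
  rewrite -IH; apply: eq_bigr => C _; congr ((_ == b)%:R).
  apply: eqmx_corank.
  apply: eqmx_trans (adds_eqmx (eqmx_refl A) (eqmx_sym (addsmxE c C))) _.
  by rewrite addsmxA.
rewrite (eq_bigr _ (fun c _ => E c)) -mulr_sumr.
rewrite (sum_rank_adds_row A (fun r => rho q k (n - r) b)).
rewrite mulnDl mul1n exprD [q ^+ n * _]mulrC -mulrA; congr (_ * _).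
have hr : (\rank A <= n)%N by exact: rank_leq_col.
rewrite subnS -/(corank A) mulrDr !mulrA mulrBr mulr1 /=.
have q0 : q != 0 by rewrite gt_eqF // card_field_gt0R.
have -> // : q ^+ n * q ^- (corank A) = q ^+ \rank A.
by rewrite -[X in q ^+ X * _](subnKC hr) exprD mulfK // expf_neq0.
Qed.

(** Only the rank [s] of [K] matters: the change of variables [C -> row_ebase K *m C] turns [K] into
    [pid_mx s], which keeps the first [s] rows of [C] and leaves the others free. *)
Lemma sum_corank_adds_mul (n k t b p : nat) (A : 'M[F]_(p, n)) (K : 'M[F]_(k, t)) :
  \sum_(C : 'M[F]_(t, n)) (corank (A + K *m C)%MS == b)%:R =
  q ^+ (t * n) * rho q (\rank K) (corank A) b.
Proof.
pose f s (C : 'M[F]_(t, n)) : R :=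
  (corank (A + (pid_mx s : 'M[F]_(s, t)) *m C)%MS == b)%:R.
transitivity (\sum_C f (\rank K) C).
  rewrite [RHS](reindex_inj (can_inj (mulKmx (row_ebase_unit K)))) /=.
  apply: eq_bigr => C _; congr ((_ == b)%:R).
  apply: eqmx_corank; rewrite mulmxA -/(row_base K).
  by apply: adds_eqmx => //; apply: eqmx_sym; apply: eqmxMr; exact: eq_row_base.
have : (\rank K <= t)%N by exact: rank_leq_col.
move: (\rank K) => s st; rewrite {}/f.
have [t' E] : exists t', t = (s + t')%N by exists (t - s)%N; rewrite subnKC.
move: E st => {K} -> _.
rewrite sum_col_mx (eq_bigr (fun C1 : 'M[F]_(s, n) => q ^+ (t' * n) *
  (corank (A + C1)%MS == b)%:R)); last first.
  move=> C1 _; rewrite (eq_bigr (fun=> (corank (A + C1)%MS == b)%:R)).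
    by rewrite sumr_const card_mx -natrX mulr_natl.
  by move=> C2 _; rewrite pid_mx_row mul_row_col mul1mx mul0mx addr0.
by rewrite -mulr_sumr sum_corank_adds mulrA -exprD -mulnDl addnC.
Qed.

Lemma sum_block_trig (m n : nat) (f : 'M[F]_(m + n) -> R) :
  \sum_(M : 'M[F]_(m + n) | is_trig_mx M) f M =
  \sum_(A : 'M[F]_m | is_trig_mx A) \sum_(D : 'M[F]_n | is_trig_mx D)
    \sum_(C : 'M[F]_(n, m)) f (block_mx A 0 C D).
Proof.
pose h (x : 'M[F]_m * ('M[F]_n * 'M[F]_(n, m))) := block_mx x.1 0 x.2.2 x.2.1.
pose h' (M : 'M[F]_(m + n)) := (ulsubmx M, (drsubmx M, dlsubmx M)).
rewrite (eq_bigr (fun A => \sum_(x | is_trig_mx x.1 && true) f (h (A, x)))).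
  rewrite pair_big /= (reindex_onto h h').
    apply: eq_big => [[A [D C]]|[A [D C]] //].
    rewrite /h /h' /= is_trig_block_mx // eqxx /=.
    by rewrite block_mxKul block_mxKdl block_mxKdr eqxx !andbT.
  move=> M; rewrite -[M]submxK is_trig_block_mx // => /andP[/eqP E _].
  by rewrite /h /h' /= block_mxKul block_mxKdl block_mxKdr E.
by move=> A _; rewrite pair_big /=.
Qed.

(** If [D] is invertible, column operations clear [C]; if [D = 0], the last column vanishes. So the
    corank rises exactly when [D = 0] and [C] lies in the row space of [A], which has probability
    [q^-1 * q ^- corank A]. *)
Lemma corank_block_trig1 (n : nat) (A : 'M[F]_n) (C : 'rV[F]_n) (D : 'M[F]_1) :
  corank (block_mx A 0 C D) =
  if D == 0 then (corank (A + C)%MS).+1 else corank A.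
Proof.
have rA := rank_leq_col A; rewrite /corank; case: eqP => [->|/eqP D0].
  rewrite block_mxEv -addsmxE.
  have -> : \rank (row_mx A (0 : 'M[F]_(n, 1)) + row_mx C (0 : 'M[F]_1))%MS =
            \rank (A + C)%MS.
    rewrite addsmxE -block_mxEv block_mxEh col_mx0 rank_row_mx0.
    by rewrite addsmxE.
  by rewrite addn1 subSn // rank_leq_col.
have uD : D \in unitmx.
  rewrite unitmxE [D]mx11_scalar det_scalar1 unitfE.
  by apply: contra D0 => /eqP E; rewrite [D]mx11_scalar E raddf0.
have -> : block_mx A 0 C D = block_mx A 0 0 D *m block_mx 1%:M 0 (invmx D *m C) 1%:M.
  rewrite mulmx_block !mulmx1 !mul0mx !mulmx0 !addr0 !add0r mulKVmx //.
rewrite mxrankMfree; last first.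
  by rewrite row_free_unit unitmxE det_lblock !det1 mulr1 unitr1.
rewrite rank_diag_block_mx (mxrank_unit uD) subnDr //.
Qed.

Lemma sum_corank_trig (n : nat) (psi : nat -> R) :
  \sum_(M : 'M[F]_n | is_trig_mx M) psi (corank M) =
  q ^+ 'C(n.+1, 2) * corank_mean q n psi.
Proof.
elim: n psi => [|n IH] psi.
  rewrite (big_pred1 (const_mx 0)) => [|C]; last first.
    rewrite /= flatmx0 [in RHS]flatmx0 eqxx; apply/is_trig_mxP; case; by case.
  by rewrite mul1r /= /corank sub0n.
pose Spsi m := q ^- m.+1 * psi m.+1 + (1 - q ^- m.+1) * psi m.
rewrite -(addn1 n) sum_block_trig.
rewrite (eq_bigr (fun A : 'M[F]_n => q ^+ n.+1 * Spsi (corank A))).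
  rewrite -mulr_sumr IH mulrA -exprD addn1 /=.
  by rewrite [in RHS]binS bin1 addnC.
move=> A _; have q0 : q != 0 by rewrite gt_eqF // card_field_gt0R.
have hr : (\rank A <= n)%N by exact: rank_leq_col.
have trig1 (D : 'M[F]_1) : is_trig_mx D.
  by apply/is_trig_mxP => i j; rewrite !ord1.
rewrite (eq_bigl predT) // (bigD1 (0 : 'M[F]_1)) //=.
under eq_bigr do rewrite corank_block_trig1 eqxx.
rewrite (sum_rank_adds_row A (fun r => psi (n - r).+1)).
rewrite (eq_bigr (fun=> q ^+ n * psi (corank A))) => [|D /negPf D0]; last first.
  under eq_bigr do rewrite corank_block_trig1 D0.
  by rewrite sumr_const card_mx mul1n -natrX mulr_natl.
rewrite sumr_const cardC1 card_mx mul1n expn1 -[_ *+ #|F|.-1]mulr_natl.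
have -> : (#|F|.-1)%:R = q - 1 :> R.
  by rewrite -subn1 natrB // ltnW // card_field_gt1.
(* If [\rank A = n], the truncated subtraction makes the arguments of [psi] differ, but the
   coefficient is then zero. *)
have -> : (q ^+ n - q ^+ \rank A) * psi (n - (\rank A).+1).+1 =
          (q ^+ n - q ^+ \rank A) * psi (corank A).
  have [E|ne] := eqVneq (\rank A) n; first by rewrite E subrr !mul0r.
  by rewrite subnSK // ltn_neqAle ne hr.
have E : q ^+ n.+1 * q ^- (corank A).+1 = q ^+ \rank A.
  rewrite -[X in q ^+ X.+1 * _](subnKC hr) -addnS exprD mulfK //.
  by rewrite expf_neq0.
rewrite /Spsi mulrDr !mulrA mulrBr E mulr1 exprS -/(corank A); ring.
Qed.

End Counting.

(** * Closed forms and moments *)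

Section CorankMean.
Variables (R : realType) (q : R).

Lemma eq_corank_mean (n : nat) (f g : nat -> R) :
  (forall m, (m <= n)%N -> f m = g m) -> corank_mean q n f = corank_mean q n g.
Proof.
elim: n f g => [|n IH] f g fg /=; first exact: fg.
by apply: IH => m mn; rewrite !fg // ltnW.
Qed.

Lemma corank_meanZD (n : nat) (a b : R) (f g : nat -> R) :
  corank_mean q n (fun m => a * f m + b * g m) =
  a * corank_mean q n f + b * corank_mean q n g.
Proof.
elim: n f g => [//|n IH] f g /=; rewrite -IH.
by apply: eq_corank_mean => m _; ring.
Qed.

Lemma corank_mean_cst (n : nat) (c : R) : corank_mean q n (fun=> c) = c.
Proof.
elim: n => [//|n IH] /=; rewrite -[RHS]IH.
by apply: eq_corank_mean => m _; ring.
Qed.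

Lemma corank_mean1B (n : nat) (f : nat -> R) :
  corank_mean q n (fun m => 1 - f m) = 1 - corank_mean q n f.
Proof.
have := corank_meanZD n 1 (-1) (fun=> 1) f.
rewrite corank_mean_cst !mul1r mulN1r => <-.
by apply: eq_corank_mean => m _; rewrite mulN1r.
Qed.

Lemma corank_mean_sum (n N : nat) (f : nat -> nat -> R) :
  corank_mean q n (fun m => \sum_(i < N) f i m) =
  \sum_(i < N) corank_mean q n (f i).
Proof.
elim: N => [|N IH].
  rewrite big_ord0 -[RHS](corank_mean_cst n); apply: eq_corank_mean => m _.
  by rewrite big_ord0.
rewrite big_ord_recr /= -IH -[X in X + _]mul1r -[X in _ + X]mul1r -corank_meanZD.
by apply: eq_corank_mean => m _; rewrite big_ord_recr /= !mul1r.
Qed.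

Definition corank_mass (n m : nat) : R := corank_mean q n (fun k => (k == m)%:R).

Lemma corank_mean_mass (n : nat) (f : nat -> R) :
  corank_mean q n f = \sum_(m < n.+1) corank_mass n m * f m.
Proof.
transitivity (corank_mean q n
   (fun k => \sum_(m < n.+1) f m * (k == m :> nat)%:R)).
  apply: eq_corank_mean => m mn.
  rewrite (bigD1 (Ordinal (mn : (m < n.+1)%N))) //= eqxx mulr1 big1 ?addr0 //.
  move=> i /negPf im; have -> : (m == i :> nat) = false.
    by rewrite eq_sym; apply: im.
  by rewrite mulr0.
rewrite (corank_mean_sum _ _ (fun i k => f i * (k == i)%:R)).
apply: eq_bigr => m _.
have := corank_meanZD n (f m) 0 (fun k => (k == m :> nat)%:R) (fun=> 0).
rewrite /= !mul0r addr0 mulrC => <-.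
by apply: eq_corank_mean => k _; rewrite addr0.
Qed.

Lemma corank_mass_gt (n m : nat) : (n < m)%N -> corank_mass n m = 0.
Proof.
move=> nm; rewrite /corank_mass -[RHS](corank_mean_cst n); apply: eq_corank_mean => k kn.
by rewrite ltn_eqF // (leq_ltn_trans kn nm).
Qed.

(** On indicator functions, the recursion of [corank_mean] is the forward equation of the chain. *)
Lemma corank_massS (n m : nat) : corank_mass n.+1 m =
  (if m is m'.+1 then q ^- m * corank_mass n m' else 0) +
  (1 - q ^- m.+1) * corank_mass n m.
Proof.
rewrite /corank_mass; case: m => [|m].
  rewrite add0r -[RHS]addr0 -[X in _ + X](mul0r (corank_mean q n (fun=> 0))).
  rewrite -corank_meanZD /=; apply: eq_corank_mean => k _.
  by case: k => [|k] /=; ring.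
rewrite -corank_meanZD /=; apply: eq_corank_mean => k _; rewrite eqSS.
congr (_ + _); first by case: eqP => [->|]; rewrite // !mulr0.
by case: eqP => [->|]; rewrite // !mulr0.
Qed.

Hypothesis q2 : 2 <= q.

Let q1 : 1 < q. Proof. by apply: lt_le_trans q2; rewrite ltr1n. Qed.

Let q0 : 0 < q. Proof. exact: lt_trans q1. Qed.
Let qX0 n : q ^+ n != 0. Proof. by rewrite expf_neq0 // gt_eqF. Qed.

Lemma qV_ge0 (n : nat) : 0 <= q ^- n.
Proof. by rewrite invr_ge0 exprn_ge0 // ltW. Qed.

Lemma qV_le1 (n : nat) : q ^- n <= 1.
Proof. by rewrite invf_le1 ?exprn_gt0 // exprn_ege1 // ltW. Qed.

Lemma one_sub_qV_gt0 (n : nat) : 0 < 1 - q ^- n.+1.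
Proof. by rewrite subr_gt0 invf_lt1 ?exprn_gt0 // exprn_egt1. Qed.

Lemma le_corank_mean (n : nat) (f g : nat -> R) :
  (forall m, f m <= g m) -> corank_mean q n f <= corank_mean q n g.
Proof.
elim: n f g => [|n IH] f g fg /=; first exact: fg.
apply: IH => m.
by rewrite lerD // ler_wpM2l ?fg ?qV_ge0 // ltW // one_sub_qV_gt0.
Qed.

Lemma corank_mass_ge0 (n m : nat) : 0 <= corank_mass n m.
Proof.
rewrite /corank_mass -[X in X <= _](corank_mean_cst n); apply: le_corank_mean => k.
exact: ler0n.
Qed.

(** The drift of [q ^+ m] is [q ^- m.+1 * (q ^+ m.+1 - q ^+ m) = 1 - q^-1], whatever [m]. *)
Lemma corank_mean_exp (n : nat) :
  corank_mean q n (fun m => q ^+ m) = 1 + n%:R * (1 - q^-1).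
Proof.
elim: n => [|n IH]; first by rewrite mul0r addr0.
rewrite -natr1 mulrDl mul1r addrA -IH -[X in X + _]mul1r.
rewrite -[X in _ + X]mulr1 -[X in _ + _ * X](corank_mean_cst n) -corank_meanZD /=.
apply: eq_corank_mean => m _; rewrite !exprS; field.
by rewrite qX0 gt_eqF.
Qed.

(** The drift of [q ^- m] is [- c * (q ^- m) ^+ 2], so by Jensen its mean satisfies
    [y k.+1 <= y k - c * y k ^+ 2], whose solutions decay like [1 / (c * n)]. *)
Lemma corank_mean_expV (n : nat) :
  corank_mean q n (fun m => q ^- m) * (1 + n%:R * (q^-1 * (1 - q^-1))) <= 1.
Proof.
set c := q^-1 * (1 - q^-1).
have qV0 : 0 < q^-1 by rewrite invr_gt0.
have qV1 : q^-1 < 1 by rewrite invf_lt1.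
have c0 : 0 < c by rewrite mulr_gt0 // subr_gt0.
have c4 : 4 * c <= 1.
  by rewrite -subr_ge0; have := sqr_ge0 (1 - 2 * q^-1); rewrite /c; nra.
pose y k := corank_mean q k (fun m => q ^- m).
have y1 k : 0 <= y k <= 1.
  rewrite -[X in X <= _](corank_mean_cst k) -[X in _ <= _ <= X](corank_mean_cst k).
  by rewrite !le_corank_mean // => m; rewrite ?qV_ge0 ?qV_le1.
have yS k : y k.+1 <= y k - c * y k ^+ 2.
  have -> : y k.+1 = y k - c * corank_mean q k (fun m => (q ^- m) ^+ 2).
    rewrite -[X in X + _]mul1r -mulNr -corank_meanZD /y /=.
    apply: eq_corank_mean => m _; rewrite /c !exprS; field.
    by rewrite qX0 gt_eqF.
  rewrite lerD2l lerN2 ler_pM2l //.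
  (* Jensen's inequality for the square, in the form of a nonnegative variance. *)
  have : 0 <= corank_mean q k (fun m => (q ^- m - y k) ^+ 2).
    by rewrite -[X in X <= _](corank_mean_cst k) le_corank_mean // => m; rewrite sqr_ge0.
  have -> : corank_mean q k (fun m => (q ^- m - y k) ^+ 2) =
      1 * corank_mean q k (fun m => (q ^- m) ^+ 2) + (- 1) * y k ^+ 2.
    transitivity (corank_mean q k (fun m => 1 * (q ^- m) ^+ 2 +
        1 * ((- 2 * y k) * q ^- m + y k ^+ 2 * 1))).
      by apply: eq_corank_mean => m _; ring.
    rewrite !corank_meanZD corank_mean_cst -/(y k); ring.
  by rewrite mul1r mulN1r subr_ge0.
rewrite -/(y n); elim: n => [|n IH].
  by rewrite mul0r addr0 mulr1; case/andP: (y1 0%N).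
have := yS n; have /andP[ya yb] := y1 n; move: IH.
rewrite -natr1; have : 0 <= n%:R * c by rewrite mulr_ge0 ?ler0n // ltW.
set s := n%:R * c; rewrite mulrDl mul1r -/s; move: (y n) (y n.+1) ya yb => z z'.
move=> z0 z1 s0 zs zz'.
apply: (@le_trans _ _ ((z - c * z ^+ 2) * (1 + (s + c)))).
  by rewrite ler_wpM2r // ; lra.
(* With [z * (1 + s) <= 1] the right-hand side is at most [(1 + c * z) * (1 - c * z)], hence at most
   1. *)
have -> : (z - c * z ^+ 2) * (1 + (s + c)) =
  z * (1 + s) * (1 - c * z) + (c * z) * (1 - c * z) by ring.
have cz : 0 <= c * z <= 1 by apply/andP; split; nra.
case/andP: cz => cz0 cz1.
have : z * (1 + s) * (1 - c * z) <= 1 - c * z by rewrite ler_piMl // subr_ge0.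
nra.
Qed.

(** * Bounds and a product formula for [rho] *)

Lemma rho_ge0 (k m b : nat) : 0 <= rho q k m b.
Proof.
elim: k m => [|k IH] m /=; first exact: ler0n.
by rewrite addr_ge0 // mulr_ge0 ?qV_ge0 // subr_ge0 qV_le1.
Qed.

Lemma rho_le1 (k m b : nat) : rho q k m b <= 1.
Proof.
elim: k m => [|k IH] m /=; first by case: (_ == _).
apply: (@le_trans _ _ (q ^- m * 1 + (1 - q ^- m) * 1)).
  by rewrite lerD // ler_wpM2l ?qV_ge0 // subr_ge0 qV_le1.
by rewrite !mulr1 subrKC.
Qed.

(** A union bound: each of the [q ^+ m - 1] nonzero vectors of length [m] is killed by a uniform
    [k * m] matrix with probability [q ^- k]. The bound satisfies the recursion of [rho] with
    equality, which drives the induction. *)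
Lemma rho0_lower (k m : nat) : 1 - rho q k m 0 <= (q ^+ m - 1) * q ^- k.
Proof.
have qm n : 0 <= q ^+ n - 1 by rewrite subr_ge0 exprn_ege1 // ltW.
elim: k m => [|k IH] m /=.
  rewrite expr0 invr1 mulr1; case: m => [|m] /=; first by rewrite expr0 !subrr.
  rewrite subr0 lerBrDr (le_trans _ (le_trans q2 _)) // exprS ler_peMr ?(ltW q0) //.
  by rewrite exprn_ege1 // ltW.
case: m => [|m].
  have := IH 0%N; rewrite !expr0 invr1 !mul1r !subrr !mul0r addr0 => h.
  exact: h.
have := IH m; have := IH m.+1; rewrite /=.
have := qV_ge0 m.+1; have := qV_le1 m.+1.
move: (rho q k m 0) (rho q k m.+1 0) => x y a1 a0 hy hx.
have -> : (q ^+ m.+1 - 1) * q ^- k.+1 =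
  q ^- m.+1 * ((q ^+ m.+1 - 1) * q ^- k) +
  (1 - q ^- m.+1) * ((q ^+ m - 1) * q ^- k).
  by rewrite !exprS; field; rewrite !qX0 gt_eqF.
have -> : 1 - (q ^- m.+1 * y + (1 - q ^- m.+1) * x) =
  q ^- m.+1 * (1 - y) + (1 - q ^- m.+1) * (1 - x) by ring.
by rewrite lerD // ler_wpM2l // subr_ge0.
Qed.

Lemma rho_lt (k m b : nat) : (m < b)%N -> rho q k m b = 0.
Proof.
elim: k m => [|k IH] m mb /=; first by rewrite ltn_eqF.
by rewrite !IH ?mulr0 ?addr0 // (leq_ltn_trans (leq_pred m)).
Qed.

Lemma rho_gt (k m b : nat) : (k + b < m)%N -> rho q k m b = 0.
Proof.
elim: k m => [|k IH] m mb /=; first by rewrite gtn_eqF.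
rewrite !IH ?mulr0 ?addr0 //; last by rewrite (leq_ltn_trans _ mb) // leq_add2r.
by case: m mb.
Qed.

Lemma qprodS (n : nat) : qprod q n.+1 = qprod q n * (1 - q ^- n.+1).
Proof. by rewrite /qprod big_nat_recr. Qed.

Lemma qprod_0 : qprod q 0 = 1.
Proof. by rewrite /qprod big_geq. Qed.

Lemma qprod_gt0 (n : nat) : 0 < qprod q n.
Proof.
by elim: n => [|n IH]; rewrite ?qprod_0 // qprodS mulr_gt0 // one_sub_qV_gt0.
Qed.

Lemma qprod_decr (m n : nat) : (m <= n)%N -> qprod q n <= qprod q m.
Proof.
move=> /subnK <-; elim: (n - m)%N => [//|k IH]; rewrite addSn qprodS.
by rewrite (le_trans _ IH) // ler_piMr ?(ltW (qprod_gt0 _)) // gerBl qV_ge0.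
Qed.

(** Here [x] is the rank, and [b] and [u] are the coranks on the two sides; this choice avoids
    subtractions. In the recursion, a dependent new row lowers [u] and an independent one lowers
    [x], so the cases [x = 0] and [u = 0] are treated apart. *)
Lemma rho_closed (x u b : nat) : rho q (x + u) (b + x) b =
  q ^- (b * u) * (qprod q (b + x) * qprod q (x + u)) /
  (qprod q b * qprod q u * qprod q x).
Proof.
have qp n : qprod q n != 0 by rewrite gt_eqF // qprod_gt0.
have d n : q ^+ n.+1 - 1 != 0 by rewrite gt_eqF // subr_gt0 exprn_egt1.
move E : (x + u)%N => k.
elim: k x u E => [|k IH] [|x] [|u] //= E.
- rewrite !addn0 eqxx muln0 -E qprod_0 expr0 mulr1n; field; exact: qp.
- have := IH 0%N u; rewrite !addn0 => ->; last by case: E.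
  have -> : (1 - q ^- b) * rho q k b.-1 b = 0.
    case: (posnP b) => [->|b0]; first by rewrite expr0 invr1 subrr mul0r.
    by rewrite rho_lt ?mulr0 // prednK.
  have -> : k = u by case: E.
  rewrite qprod_0 mulnS exprD; field.
  by rewrite !qp !qX0.
- have kx : k = x by move: E; rewrite addn0 => -[].
  rewrite addnS rho_gt; last by rewrite kx; lia.
  rewrite /= kx; have := IH x 0%N; rewrite kx addn0 => -> //.
  rewrite !qprodS !qprod_0 muln0 expr0; field.
  by rewrite !qp !d !qX0.
- rewrite (IH x.+1 u); last by move: E; rewrite addnS => -[].
  rewrite addnS /= (IH x u.+1); last by move: E => -[].
  have -> : k = (x.+1 + u)%N by move: E; rewrite addnS => -[].
  rewrite !addSn !qprodS mulnS !exprS !exprD; field.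
  by rewrite -!exprS !qp !d !qX0 gt_eqF.
Qed.

(** In [rho_closed] with [u = k + b - m] positive, [q ^- (b * u)] is at most [q ^- b], and the
    ratios of [qprod] with increasing index are at most 1. *)
Lemma rho_upper (k m b : nat) : (m < k + b)%N ->
  rho q k m b <= q ^- b / qprod q (k + b - m).
Proof.
move=> mkb; have [mb|bm] := ltnP m b.
  by rewrite rho_lt // divr_ge0 ?qV_ge0 // ltW // qprod_gt0.
have [x mE] : exists x, m = (b + x)%N by exists (m - b)%N; rewrite subnKC.
have [u kE] : exists u, k = (x + u.+1)%N.
  by exists (k + b - m).-1; move: mkb; rewrite mE; lia.
have -> : (k + b - m = u.+1)%N by rewrite mE kE; lia.
rewrite mE kE rho_closed.
have qp n : 0 < qprod q n := qprod_gt0 n.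
have -> : q ^- (b * u.+1) * (qprod q (b + x) * qprod q (x + u.+1)) /
    (qprod q b * qprod q u.+1 * qprod q x) =
    q ^- (b * u.+1) * (qprod q (b + x) / qprod q b) *
    (qprod q (x + u.+1) / qprod q x) / qprod q u.+1.
  by field; rewrite !gt_eqF // exprn_gt0.
rewrite ler_pM2r ?invr_gt0 // -[leRHS]mulr1 ler_pM //.
- by rewrite mulr_ge0 ?qV_ge0 // divr_ge0 // ltW.
- by rewrite divr_ge0 // ltW.
- rewrite -[leRHS]mulr1 ler_pM ?qV_ge0 ?divr_ge0 // ?(ltW (qp _)) //.
    rewrite lef_pV2 ?posrE ?exprn_gt0 // ler_weXn2l // ?leq_pmulr // ltW //.
  by rewrite ler_pdivrMr // mul1r qprod_decr // leq_addr.
- by rewrite ler_pdivrMr // mul1r qprod_decr // leq_addr.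
Qed.

(** The transition matrix of the chain is bidiagonal, so its eigenvalues are the holding
    probabilities [1 - q ^- j.+1]. This is the coefficient, in the mass at [m], of the [n]-th power
    of the eigenvalue with [j = m - a]. *)
Definition mass_coef (m a : nat) : R :=
  (- 1) ^+ a * q ^- 'C(a, 2) / (qprod q a * qprod q (m - a)).

Lemma mass_coefS (m a : nat) : (a <= m)%N ->
  q ^- (m - a) * (1 - q ^- a.+1) * mass_coef m.+1 a.+1 =
  - (q ^- m * mass_coef m a).
Proof.
move=> /subnK; set s := (m - a)%N => <-; rewrite /mass_coef subSS addnK.
rewrite binS bin1 !exprD qprodS !exprS; field.
have qp n : qprod q n != 0 by rewrite gt_eqF // qprod_gt0.
have d n : q ^+ n.+1 - 1 != 0 by rewrite gt_eqF // subr_gt0 exprn_egt1.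
by rewrite -!exprS !qp !qX0 d gt_eqF.
Qed.

Lemma mass_coefSl (m a : nat) : (a <= m)%N ->
  (1 - q ^- (m.+1 - a)) * mass_coef m.+1 a = mass_coef m a.
Proof.
move=> am; rewrite /mass_coef subSn // qprodS !exprS; field.
have qp n : qprod q n != 0 by rewrite gt_eqF // qprod_gt0.
have d n : q ^+ n.+1 - 1 != 0 by rewrite gt_eqF // subr_gt0 exprn_egt1.
by rewrite -!exprS !qp !qX0 d gt_eqF.
Qed.

(** The q-binomial theorem in base [q^-1] at argument 1. It is the initial condition at time 0 for
    the spectral expansion. *)
Lemma sum_mass_coef (m : nat) : \sum_(a < m.+1) mass_coef m a = (m == 0%N)%:R.
Proof.
have H n : (1 - q ^- n.+1) * \sum_(a < n.+2) mass_coef n.+1 a =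
           (1 - q ^- n) * \sum_(a < n.+1) mass_coef n a.
  rewrite mulr_sumr.
  (* Splitting [1 - q ^- n.+1] as [(1 - q ^- (n.+1 - a)) + q ^- (n.+1 - a) * (1 - q ^- a)] reduces
     each half to the sum for [n]. *)
  rewrite (eq_bigr (fun a : 'I_n.+2 => (1 - q ^- (n.+1 - a)) * mass_coef n.+1 a +
      q ^- (n.+1 - a) * (1 - q ^- a) * mass_coef n.+1 a)); last first.
    move=> a _; have an : (a <= n.+1)%N by rewrite -ltnS.
    rewrite -mulrDl; congr (_ * _); rewrite mulrBr mulr1.
    by rewrite -invfM -exprD subnK // addrA subrK.
  rewrite big_split /= big_ord_recr /= subnn expr0 invr1 subrr mul0r addr0.
  rewrite [X in _ + X]big_ord_recl /= expr0 invr1 subrr mulr0 mul0r add0r.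
  rewrite mulrBl mul1r; congr (_ + _).
    by apply: eq_bigr => a _; rewrite mass_coefSl // -ltnS.
  rewrite mulr_sumr -sumrN; apply: eq_bigr => a _.
  by rewrite /bump leq0n add1n subSS mass_coefS // -ltnS.
elim: m => [|m IH].
  by rewrite big_ord1 /mass_coef subnn qprod_0 bin0n !expr0 !mulr1 !invr1 !mulr1 eqxx.
have := H m; rewrite IH; case: m {IH} => [|m] /=.
  rewrite expr0 invr1 subrr mul0r => /eqP; rewrite mulf_eq0.
  by rewrite gt_eqF ?one_sub_qV_gt0 //= => /eqP.
rewrite mulr0 => /eqP; rewrite mulf_eq0.
by rewrite gt_eqF ?one_sub_qV_gt0 //= => /eqP.
Qed.

(** The forward equation is checked one eigenvalue at a time. *)
Lemma corank_massE (n m : nat) : corank_mass n m =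
  \sum_(a < m.+1) (1 - q ^- (m - a).+1) ^+ n * mass_coef m a.
Proof.
elim: n m => [|n IH] m.
  rewrite [LHS]/corank_mass /= eq_sym -sum_mass_coef.
  by apply: eq_bigr => a _; rewrite expr0 mul1r.
rewrite corank_massS IH; case: m => [|m].
  by rewrite add0r !big_ord1 [_ ^+ n.+1]exprS !mulrA.
rewrite IH !mulr_sumr.
(* The term [a = 0] carries the one eigenvalue that does not occur at level [m]; elsewhere the shift
   from [a] to [a.+1] aligns equal eigenvalues of the two levels. *)
rewrite [X in _ + X]big_ord_recl [in RHS]big_ord_recl /= addrCA; congr (_ + _).
  by rewrite [_ ^+ n.+1]exprS !mulrA.
rewrite -big_split /=; apply: eq_bigr => a _.
have am : (a <= m)%N by rewrite -ltnS.
rewrite /bump leq0n add1n subSS [_ ^+ n.+1]exprS.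
have := mass_coefS am; set c := mass_coef m.+1 a.+1 => E.
have -> : mass_coef m a = - q ^+ m * (q ^- (m - a) * (1 - q ^- a.+1) * c).
  by rewrite E mulrNN mulrA mulfV // mul1r.
have Em : q ^+ m = q ^+ (m - a) * q ^+ a by rewrite -exprD subnK.
rewrite [q ^+ m.+2]exprS [q ^+ m.+1]exprS Em !exprS; field.
by rewrite !qX0 gt_eqF.
Qed.

End CorankMean.

(** * Persistent Betti numbers as coranks *)

Section BettiRank.
Variable F : fieldType.

Definition row_of (n : nat) (v : nat -> F^o) : 'rV[F]_n := \row_(i < n) v i.

Definition of_row (n : nat) (u : 'rV[F]_n) : nat -> F^o :=
  fun i => if insub i is Some i' then u 0 i' else 0.

Lemma of_rowK (n : nat) (u : 'rV[F]_n) : row_of n (of_row u) = u.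
Proof. by apply/rowP => i; rewrite mxE /of_row valK. Qed.

Lemma Z_of_row (n : nat) (u : 'rV[F]_n) : Z_ n (of_row u).
Proof. by move=> i ni; rewrite /of_row insubF // ltnNge ni. Qed.

(** Existence of coordinates modulo [W] says that [B + M] is everything; their uniqueness says that
    [B] is free and meets [M] trivially. *)
Lemma basis_mod_row (n p d : nat) (M : 'M[F]_(p, n)) (W : set (nat -> F^o))
    (b : 'I_d -> nat -> F^o) :
  (forall v, Z_ n v -> W v <-> (row_of n v <= M)%MS) ->
  basis_mod (Z_ n) W b -> d = (n - \rank M)%N.
Proof.
move=> WM [bZ bW]; pose B := \matrix_(i < d) row_of n (b i).
have Zsum (c : 'rV[F]_d) (v : nat -> F^o) : Z_ n v ->
    Z_ n (v - \sum_(i < d) c 0 i *: b i).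
  move=> vn i ni; rewrite !fctE /= vn // fct_sumE big1 ?subr0 // => j _.
  by rewrite !fctE (bZ j i ni) scaler0.
have rowE (c : 'rV[F]_d) (v : nat -> F^o) :
    row_of n (v - \sum_(i < d) c 0 i *: b i) = row_of n v - c *m B.
  apply/rowP => j; rewrite !mxE !fctE; congr (_ - _).
  rewrite fct_sumE; apply: eq_bigr => i _; by rewrite !mxE.
have key (v : 'rV[F]_n) : exists! c : 'rV[F]_d, (v - c *m B <= M)%MS.
  have [c [cW cu]] := bW _ (Z_of_row v).
  exists c; split.
    by move/WM: cW; rewrite rowE of_rowK; apply; apply: Zsum; exact: Z_of_row.
  move=> c' c'M; apply: cu; apply/WM; first by apply: Zsum; exact: Z_of_row.
  by rewrite rowE of_rowK.
have full : \rank (B + M)%MS = n.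
  apply/eqP; rewrite -[_ == _]/(row_full _) -sub1mx; apply/row_subP => i.
  have [c [cM _]] := key (row i 1%:M).
  rewrite -(subrK (c *m B) (row i 1%:M)) addrC addmx_sub_adds //.
  exact: submxMl.
have indep (c : 'rV[F]_d) : (c *m B <= M)%MS -> c = 0.
  move=> cM; have [c0 [_ cu]] := key 0.
  have c0N : c0 = - c by apply: cu; rewrite mulNmx sub0r opprK.
  have c00 : c0 = 0 by apply: cu; rewrite mul0mx subr0 sub0mx.
  by rewrite -[c]opprK -c0N c00 oppr0.
have fB : row_free B.
  by apply: inj_row_free => c cB; apply: indep; rewrite cB sub0mx.
have cap : (B :&: M)%MS = 0.
  apply/eqP; rewrite -submx0; apply/rV_subP => u.
  by rewrite sub_capmx => /andP[/submxP[c ->] /indep ->]; rewrite mul0mx sub0mx.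
have := mxrank_disjoint_sum cap; rewrite full (eqP fB) => nE.
apply/eqP; rewrite -(eqn_add2r (\rank M)) subnK ?rank_leq_col //.
by apply/eqP/esym.
Qed.

Lemma ex_basis_mod_row (n p : nat) (M : 'M[F]_(p, n)) (W : set (nat -> F^o)) :
  (forall v, Z_ n v -> W v <-> (row_of n v <= M)%MS) ->
  exists d (b : 'I_d -> nat -> F^o), basis_mod (Z_ n) W b.
Proof.
move=> WM; pose B := row_base (M^C)%MS.
exists (\rank (M^C)%MS), (fun i => of_row (row i B)).
split=> [i|v vn]; first exact: Z_of_row.
have rowE (c : 'rV[F]_(\rank (M^C)%MS)) :
    W (v - \sum_i c 0 i *: (of_row (row i B) : nat -> F^o)) <->
    (row_of n v - c *m B <= M)%MS.
  rewrite WM; last first.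
    move=> i ni; rewrite !fctE /= vn // fct_sumE big1 ?subr0 // => j _.
    by rewrite !fctE (Z_of_row _ ni) scaler0.
  have -> // : row_of n (v - \sum_i c 0 i *: (of_row (row i B) : nat -> F^o)) =
    row_of n v - c *m B.
  apply/rowP => j; rewrite !mxE !fctE; congr (_ - _).
  rewrite fct_sumE; apply: eq_bigr => i _.
  by rewrite !fctE /of_row valK mxE.
have : (row_of n v <= M + M^C)%MS.
  by rewrite submx_full // addsmx_compl_full.
move=> /sub_addsmxP[[u1 u2] /= vE].
have /submxP[c cE] : (u2 *m M^C <= B)%MS by rewrite eq_row_base submxMl.
exists c; split; first by apply/rowE; rewrite vE cE addrK submxMl.
move=> c' /rowE c'M; apply: (row_free_inj (row_base_free (M^C)%MS)) => /=.
apply/eqP; rewrite -subr_eq0 -/B -submx0 -(capmx_compl M) sub_capmx.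
apply/andP; split; last by rewrite -mulmxBl -(eq_row_base (M^C)%MS) submxMl.
have -> : c *m B - c' *m B = (row_of n v - c' *m B) - (row_of n v - c *m B).
  by rewrite opprB [RHS]addrC addrA subrK.
by rewrite addmx_sub // eqmx_opp vE cE addrK submxMl.
Qed.

(** [dim_quotient] selects some admissible [d], so both the existence of a basis and the uniqueness
    of its size are needed. *)
Lemma dim_quotient_row (n p : nat) (M : 'M[F]_(p, n)) (W : set (nat -> F^o)) :
  (forall v, Z_ n v -> W v <-> (row_of n v <= M)%MS) ->
  dim_quotient (Z_ n) W = (n - \rank M)%N.
Proof.
move=> WM; have [d bd] := ex_basis_mod_row WM.
rewrite /dim_quotient; set S := [set d | _].
have [b] : S (xget 0%N S) by apply: xgetPex; exists d.
exact: basis_mod_row.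
Qed.

Lemma corner_block (L : nat -> nat -> F) (r t : nat) :
  (forall i j, (i < j)%N -> L i j = 0) -> ursubmx (corner L (r + t)) = 0.
Proof.
by move=> L0; apply/matrixP => i j; rewrite !mxE L0 //= ltn_addr.
Qed.

Lemma persistent_betti_corank (L : nat -> nat -> F) (r t : nat) :
  (forall i j, (i < j)%N -> L i j = 0) ->
  let M := corner L (r + t) in
  persistent_betti L r (r + t) =
  corank (ulsubmx M + kermx (drsubmx M) *m dlsubmx M)%MS.
Proof.
move=> L0 M; apply: dim_quotient_row => v vr.
have vE : row_of (r + t) v = row_mx (row_of r v) 0.
  apply/rowP => j; rewrite !mxE; case: splitP => k jk; first by rewrite mxE jk.
  by rewrite mxE jk vr // leq_addr.
have mulE (x : nat -> F^o) : Z_ (r + t) x ->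
    row_of (r + t) (vecmat_mul L x) = row_of (r + t) x *m M.
  move=> xs; apply/rowP => j; rewrite !mxE (vecmat_mulE _ _ xs).
  by apply: eq_bigr => i _; rewrite !mxE.
have MblockE (y1 : 'rV[F]_r) (y2 : 'rV[F]_t) : row_mx y1 y2 *m M =
    row_mx (y1 *m ulsubmx M + y2 *m dlsubmx M) (y2 *m drsubmx M).
  rewrite -{1}[M]submxK corner_block // mul_row_block mulmx0 add0r //.
split.
  move=> [_ [x xs xv]]; have := mulE _ xs; rewrite xv vE.
  rewrite -(hsubmxK (row_of (r + t) x)) MblockE => /eq_row_mx[-> /esym].
  move=> /sub_kermxP/submxP[z ->].
  by rewrite -mulmxA addmx_sub_adds // submxMl.
move=> /sub_addsmxP[[y1 y2] /= vy]; split=> //.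
pose x := row_mx y1 (y2 *m kermx (drsubmx M)).
exists (of_row x); first exact: Z_of_row.
apply/funext => j; have [js|sj] := ltnP j (r + t).
  have := mulE _ (Z_of_row x); rewrite of_rowK MblockE -mulmxA.
  rewrite -mulmxA mulmx_ker mulmx0 -vy -vE => /rowP/(_ (Ordinal js)); by rewrite !mxE.
(* Beyond column [r + t] the first [r + t] rows vanish by triangularity. *)
rewrite (vecmat_mulE _ _ (Z_of_row x)) vr ?(leq_trans (leq_addr _ _) sj) //.
by rewrite big1 // => i _; rewrite L0 ?mulr0 // (leq_trans (ltn_ord i) sj).
Qed.

Lemma dim_ker_corner_corank (L : nat -> nat -> F) (n : nat) :
  dim_ker_corner L n = corank (corner L n).
Proof. by rewrite /dim_ker_corner mxrank_ker. Qed.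

End BettiRank.

(** * Uniform lower triangular matrices *)

Section DiscreteProbability.
Context d (T : measurableType d) (R : realType) (P : probability T R).

Lemma prob_fineK (A : set T) : measurable A -> (fine (P A))%:E = P A.
Proof. by move=> mA; rewrite fineK // fin_num_measure. Qed.

Lemma discrete_rv_finType (S : finType) (X : T -> S) :
  (forall s, measurable (X @^-1` [set s])) -> discrete_rv X.
Proof.
move=> mX A.
have -> : X @^-1` A = \bigcup_(s in A) X @^-1` [set s].
  by apply/seteqP; split=> [w Aw|w [s As] /= ->//]; exists (X w).
by apply: fin_bigcup_measurable => //; exact: finite_finset.
Qed.

Lemma prob_seq (S : eqType) (X : T -> S) (G : set S) (l : seq S) :
  discrete_rv X -> uniq l ->
  P [set w | X w \in l /\ G (X w)] =
  (\sum_(s <- l) `[< G s >]%:R * fine (P (X @^-1` [set s])))%:E.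
Proof.
move=> mX; elim: l => [|s l IH] /=.
  by move=> _; rewrite big_nil -[RHS](measure0 P); congr (P _); apply/seteqP; split=> w [].
move=> /andP[sl ul]; rewrite big_cons EFinD -(IH ul).
have -> : [set w | X w \in s :: l /\ G (X w)] =
    (X @^-1` ([set s] `&` G)) `|` [set w | X w \in l /\ G (X w)].
  apply/seteqP; split=> w /=; rewrite inE.
    by move=> [/orP[/eqP|] ? ?]; [left|right].
  by move=> [[-> ?]|[-> ?]]; rewrite ?eqxx ?orbT.
have mU : measurable (X @^-1` ([set s] `&` G)) by exact: mX.
have mV : measurable [set w | X w \in l /\ G (X w)].
  exact: (mX [set x | x \in l /\ G x]).
rewrite (measureU _ mU mV); last first.
  by apply/seteqP; split=> w //= [[-> _] [sl' _]]; rewrite sl' in sl.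
congr (_ + _)%E; case: asboolP => Gs.
  rewrite mul1r prob_fineK; last exact: mX.
  by congr (P _); apply/seteqP; split=> [w []|w /= ->].
rewrite mul0r -[RHS](measure0 P); congr (P _).
by apply/seteqP; split=> w //= [-> /Gs].
Qed.

Lemma prob_finType (S : finType) (X : T -> S) (G : set S) :
  discrete_rv X ->
  P (X @^-1` G) = (\sum_(s : S) `[< G s >]%:R * fine (P (X @^-1` [set s])))%:E.
Proof.
move=> mX; rewrite -big_enum -(prob_seq _ mX) ?enum_uniq //.
by congr (P _); apply/seteqP; split=> [w /=|w []//]; rewrite mem_enum.
Qed.

Variables (F : finFieldType) (L : nat -> nat -> T -> F).
Hypothesis hL : uniform_lower_triangular P L.
Notation q := (#|F|%:R : R).

Definition rcorner (n : nat) (w : T) : 'M[F]_n := corner (fun i j => L i j w) n.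

Lemma discrete_rcorner (n : nat) : discrete_rv (rcorner n).
Proof.
apply: discrete_rv_finType => M.
have -> : rcorner n @^-1` [set M] =
   \bigcap_(ij in [set: 'I_n * 'I_n]) L ij.1 ij.2 @^-1` [set M ij.1 ij.2].
  apply/seteqP; split=> w /=.
    by move=> <- [i j] _ /=; rewrite mxE.
  by move=> h; apply/matrixP => i j; rewrite mxE; exact: (h (i, j)).
by apply: fin_bigcap_measurable => // -[i j] _; case: hL => + _ _ _; apply.
Qed.

Lemma rcorner_trig (n : nat) (w : T) : is_trig_mx (rcorner n w).
Proof. by apply/is_trig_mxP => i j ij; rewrite mxE; case: hL => _ + _ _; apply. Qed.

Lemma ex_prob_rcorner (n : nat) : exists c : R, forall M : 'M[F]_n,
  P (rcorner n @^-1` [set M]) = (c * (is_trig_mx M)%:R)%:E.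
Proof.
pose J := [fset ij | ij in [seq (i, j) | i <- iota 0 n, j <- iota 0 i.+1]]%fset.
have JP i j : (i, j) \in J = (j <= i < n)%N.
  rewrite inE; apply/allpairsPdep/idP => [[i' [j' []]]|/andP[ji jn]].
    by rewrite !mem_iota !add0n /= ltnS => ? ? [-> ->]; apply/andP.
  by exists i, j; rewrite !mem_iota !add0n /= ltnS.
exists (\prod_(ij <- J) q^-1) => M.
have [Mt|Mt] := boolP (is_trig_mx M); last first.
  rewrite mulr0 -[RHS](measure0 P); congr (P _); apply/seteqP; split=> w //= E.
  by move: Mt; rewrite -E rcorner_trig.
(* Quantifying over ordinals that represent [ij] defines the constraint for every pair of naturals,
   without casts. *)
pose A (ij : nat * nat) :=
  [set a | forall i j : 'I_n, (i : nat, j : nat) = ij -> a = M i j].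
case: (hL) => [_ L0 LU Lind].
have JD : [set` J] `<=` [set ij | (ij.2 <= ij.1)%N].
  by move=> [i j] /=; rewrite JP => /andP[].
transitivity (P (\bigcap_(ij in [set` J]) (L ij.1 ij.2 @^-1` A ij))).
  congr (P _); apply/seteqP; split=> w.
    by move=> wM [i j] _ i' j' [<- <-]; rewrite -wM mxE.
  move=> h; apply/matrixP => i j; rewrite mxE.
  have [ij|ji] := ltnP i j; first by rewrite L0 // (is_trig_mxP Mt).
  by apply: (h (i : nat, j : nat)) => //=; rewrite JP ji ltn_ord.
rewrite (Lind J JD A) mulr1 -prodEFin; apply: eq_big_seq => -[i j].
rewrite JP => /andP[ji jn] /=.
rewrite -(LU i j (M (Ordinal jn) (Ordinal (leq_ltn_trans ji jn))) ji).
congr (P _); congr (_ @^-1` _); apply/seteqP; split=> a.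
  exact.
by move=> /= -> i' j' [ii jj]; congr (M _ _); apply: val_inj.
Qed.

Lemma prob_rcorner (n : nat) (G : set 'M[F]_n) :
  P (rcorner n @^-1` G) =
  (q ^- 'C(n.+1, 2) * \sum_(M : 'M[F]_n | is_trig_mx M) `[< G M >]%:R)%:E.
Proof.
(* The constant [c] is identified by the total mass. *)
have [c cP] := ex_prob_rcorner n.
have prE (H : set 'M[F]_n) : P (rcorner n @^-1` H) =
    (c * \sum_(M : 'M[F]_n | is_trig_mx M) `[< H M >]%:R)%:E.
  rewrite prob_finType; last exact: discrete_rcorner.
  rewrite mulr_sumr [in RHS]big_mkcond; congr (_%:E); apply: eq_bigr => M _.
  by rewrite cP /= mulrCA; case: is_trig_mx; rewrite ?mulr1 // !mulr0.
have : P (rcorner n @^-1` setT) = 1%E by rewrite preimage_setT probability_setT.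
rewrite prE prE => -[].
rewrite (eq_bigr (fun=> 1)) => [|M _]; last by rewrite asboolT.
rewrite (@sum_corank_trig F R n (fun=> 1)).
rewrite corank_mean_cst mulr1 => cq; congr ((_ * _)%:E).
have qX0 : q ^+ 'C(n.+1, 2) != 0.
  by rewrite expf_neq0 // gt_eqF // card_field_gt0R.
by apply: (mulIf qX0); rewrite cq mulVf.
Qed.

Lemma prob_dim_ker (n m : nat) :
  P [set w | dim_ker_corner (fun i j => L i j w) n = m] = (corank_mass q n m)%:E.
Proof.
have -> : [set w | dim_ker_corner (fun i j => L i j w) n = m] =
    rcorner n @^-1` [set M | corank M = m].
  by apply/seteqP; split=> w /=; rewrite dim_ker_corner_corank.
rewrite prob_rcorner; congr (_%:E).
rewrite (eq_bigr (fun M : 'M[F]_n => (corank M == m :> nat)%:R)); last first.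
  by move=> M _; congr (_%:R); congr nat_of_bool; apply/asboolP/eqP.
rewrite (@sum_corank_trig F R _ (fun k => (k == m)%:R)) mulKf //.
by rewrite expf_neq0 // gt_eqF // card_field_gt0R.
Qed.

Definition betti_mx (r t : nat) (M : 'M[F]_(r + t)) : nat :=
  corank (ulsubmx M + kermx (drsubmx M) *m dlsubmx M)%MS.

Lemma persistent_betti_rcorner (r t : nat) (w : T) :
  persistent_betti (fun i j => L i j w) r (r + t) =
  betti_mx (rcorner (r + t) w).
Proof. by apply: persistent_betti_corank => i j ij; case: hL => _ + _ _; apply. Qed.

Lemma discrete_persistent_betti (r t : nat) :
  discrete_rv (fun w => persistent_betti (fun i j => L i j w) r (r + t)).
Proof.
move=> A; have := discrete_rcorner (betti_mx (r := r) (t := t) @^-1` A).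
by congr measurable; apply/seteqP; split=> w /=; rewrite persistent_betti_rcorner.
Qed.

Lemma prob_persistent_betti (r t b : nat) :
  P [set w | persistent_betti (fun i j => L i j w) r (r + t) = b] =
  (corank_mean q r (fun m => corank_mean q t (fun k => rho q k m b)))%:E.
Proof.
have -> : [set w | persistent_betti (fun i j => L i j w) r (r + t) = b] =
    rcorner (r + t) @^-1` [set M | betti_mx M = b].
  by apply/seteqP; split=> w /=; rewrite persistent_betti_rcorner.
have q0 : q != 0 by rewrite gt_eqF // card_field_gt0R.
rewrite prob_rcorner; congr (_%:E).
rewrite (eq_bigr (fun M : 'M[F]_(r + t) => (betti_mx M == b)%:R)); last first.
  by move=> M _; congr (_%:R); congr nat_of_bool; apply/asboolP/eqP.
rewrite sum_block_trig.
rewrite (eq_bigr (fun A : 'M[F]_r => q ^+ (t * r) * (q ^+ 'C(t.+1, 2) *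
   corank_mean q t (fun k => rho q k (corank A) b)))); last first.
  move=> A _; rewrite -sum_corank_trig mulr_sumr; apply: eq_bigr => D _.
  rewrite -[corank D](mxrank_ker D) -sum_corank_adds_mul; apply: eq_bigr => C _.
  by rewrite /betti_mx block_mxKul block_mxKdr block_mxKdl.
rewrite -mulr_sumr -mulr_sumr.
rewrite (@sum_corank_trig F R _ (fun m => corank_mean q t (fun k => rho q k m b))).
(* The free entries of the triangle are those of [C], [D] and [A]. *)
rewrite (_ : 'C((r + t).+1, 2) = t * r + 'C(t.+1, 2) + 'C(r.+1, 2))%N.
  by rewrite !exprD; field; rewrite !expf_neq0.
clear; elim: r => [|r IH]; first by rewrite muln0 !add0n (@bin_small 1 2) // addn0.
by rewrite addSn binS bin1 IH ['C(r.+2, 2)]binS bin1 mulnS; lia.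
Qed.

End DiscreteProbability.

(** * Limits of the closed forms *)

Section Limits.
Variable R : realType.

Lemma qprod_ge (q : R) (n : nat) : 2 <= q -> 4^-1 <= qprod q n.
Proof.
move=> q2; have q0 : 0 < q by apply: lt_le_trans q2; rewrite ltr0n.
have qV n' : q ^- n' <= 2 ^- n'.
  by rewrite lef_pV2 ?posrE ?exprn_gt0 // lerXn2r ?nnegrE // ltW.
case: n => [|n]; first by rewrite qprod_0; lra.
(* The surplus [h = 2 ^- n.+2] closes the induction: [(1/4 + h) * (1 - h) >= 1/4 + h / 2] as soon as
   [h <= 1/4]. *)
suff : 4^-1 + 2 ^- n.+2 <= qprod q n.+1.
  by apply: le_trans; rewrite lerDl invr_ge0 exprn_ge0.
elim: n => [|n IH].
  rewrite qprodS qprod_0 mul1r; have := qV 1%N; rewrite expr1 expr2; lra.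
rewrite qprodS; have := qV n.+2; have := qV_ge0 q2 n.+2; move: IH.
have : 2 ^- n.+2 <= 4^-1 :> R.
  rewrite lef_pV2 ?posrE ?exprn_gt0 // !exprS.
  have := @exprn_ege1 R n 2 ltac:(by rewrite ler1n); lra.
have : 0 < 2 ^- n.+2 :> R by rewrite invr_gt0 exprn_gt0.
have -> : 2 ^- n.+3 = 2 ^- n.+2 / 2 :> R.
  by rewrite [2 ^+ n.+3]exprS invfM mulrC.
set h := 2 ^- n.+2; set x := q ^- n.+2; set y := qprod q n.+1.
move=> h0 h4 yh x0 xh.
apply: (@le_trans _ _ ((4^-1 + h) * (1 - h))); first nra.
by rewrite ler_pM //; lra.
Qed.

Lemma qprod_cvg (q : R) : 2 <= q -> qprod q n @[n --> \oo] --> qprod_infty q.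
Proof.
move=> q2; apply: nonincreasing_is_cvgn.
  by move=> m n mn; exact: qprod_decr.
by exists 4^-1 => _ [n _ <-]; exact: qprod_ge.
Qed.

Lemma qprod_infty_gt0 (q : R) : 2 <= q -> 0 < qprod_infty q.
Proof.
move=> q2; apply: (@lt_le_trans _ _ 4^-1); first by rewrite invr_gt0.
apply: limr_ge; first by apply: cvgP; exact: qprod_cvg.
by near=> n; exact: qprod_ge.
Unshelve. all: by end_near. Qed.

Lemma cvgn_sum (I : Type) (l : seq I) (f : nat -> I -> R) (g : I -> R) :
  (forall i, f n i @[n --> \oo] --> g i) ->
  \sum_(i <- l) f n i @[n --> \oo] --> \sum_(i <- l) g i.
Proof.
move=> fg; elim: l => [|i l IH].
  by rewrite big_nil; under eq_fun do rewrite big_nil; exact: cvg_cst.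
by rewrite big_cons; under eq_fun do rewrite big_cons; exact: cvgD.
Qed.

Lemma sum_halves (K M : nat) : (K <= M)%N ->
  \sum_(K <= a < M) 2 ^- a = 2 * (2 ^- K - 2 ^- M) :> R.
Proof.
move=> /subnKC <-; elim: (M - K)%N => [|k IH].
  by rewrite addn0 big_geq // subrr mulr0.
rewrite addnS big_nat_recr ?leq_addr //= IH.
by rewrite [2 ^+ _.+1]exprS invfM; field; rewrite !expf_neq0.
Qed.

Lemma tail_halves (u : nat -> R) (C : R) (K M : nat) :
  (forall a, `|u a| <= C * 2 ^- a) -> (K <= M)%N ->
  `|\sum_(a < M) u a - \sum_(a < K) u a| <= 2 * C * 2 ^- K.
Proof.
move=> uC KM; rewrite -!(big_mkord xpredT) (big_cat_nat _ KM) //= addrAC subrr add0r.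
apply: le_trans (ler_norm_sum _ _ _) _.
apply: le_trans (ler_sum _ (fun a _ => uC a)) _.
rewrite -mulr_sumr sum_halves // mulrCA -mulrA ler_wpM2l //.
have C0 : 0 <= C by have := uC 0%N; rewrite expr0 invr1 mulr1; exact: le_trans.
by rewrite ler_wpM2l // gerBl invr_ge0 exprn_ge0.
Qed.

Lemma tannery (u : nat -> nat -> R) (v : nat -> R) (C : R) (N : nat -> nat) :
  (forall a, u n a @[n --> \oo] --> v a) ->
  (forall n a, `|u n a| <= C * 2 ^- a) ->
  N n @[n --> \oo] --> \oo ->
  \sum_(a < N n) u n a @[n --> \oo] --> limn (series v).
Proof.
move=> uv uC Noo.
have C0 : 0 <= C by have := uC 0%N 0%N; rewrite expr0 invr1 mulr1; exact: le_trans.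
have vC a : `|v a| <= C * 2 ^- a.
  have h : `|u n a| @[n --> \oo] --> `|v a| by apply: cvg_norm.
  rewrite -(cvg_lim _ h) //; apply: limr_le; first by apply: cvgP; exact: h.
  by near=> n; exact: uC.
have small e : 0 < e -> exists K, 2 * C * 2 ^- K < e.
  move=> e0.
  have : 2 * C * 2 ^- n @[n --> \oo] --> (2 * C * 0 : R).
    apply: cvgMl_tmp.
    rewrite (_ : (fun n => 2 ^- n) = GRing.exp (2^-1 : R)); last first.
      by apply/funext => n; rewrite exprVn.
    by apply: cvg_expr; rewrite ger0_norm // invf_lt1 // ltr1n.
  rewrite mulr0 => /cvgrPdist_lt/(_ _ e0)[K _ /(_ K (leqnn K))].
  rewrite /= sub0r normrN ger0_norm => [|]; first by exists K.
  by rewrite !mulr_ge0 ?invr_ge0.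
have vcvg : cvgn (series v).
  apply: normed_cvg; apply: (@series_le_cvg _ _ (fun a => C * 2 ^- a)).
  - by move=> n /=.
  - by move=> n; rewrite mulr_ge0 ?invr_ge0.
  - by move=> n /=; exact: vC.
  rewrite (_ : (fun a => C * 2 ^- a) = geometric C (2^-1 : R)); last first.
    by apply/funext => n; rewrite /geometric /= exprVn.
  by apply: is_cvg_geometric_series; rewrite ger0_norm // invf_lt1 // ltr1n.
have vtail K : `|limn (series v) - \sum_(a < K) v a| <= 2 * C * 2 ^- K.
  have h : `|series v n - \sum_(a < K) v a| @[n --> \oo] -->
      `|limn (series v) - \sum_(a < K) v a|.
    by apply: cvg_norm; apply: cvgB => //; exact: cvg_cst.
  rewrite -(cvg_lim _ h) //; apply: limr_le; first by apply: cvgP; exact: h.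
  near=> n; rewrite /series /= big_mkord; apply: tail_halves => //.
  by near: n; exact: nbhs_infty_ge.
apply/cvgrPdist_lt => e e0.
have [K KE] := small (e / 3) ltac:(by rewrite divr_gt0).
have sumK : \sum_(a < K) u n a @[n --> \oo] --> \sum_(a < K) v a.
  by apply: cvgn_sum => a; exact: uv.
have /cvgrPdist_lt/(_ _ (divr_gt0 e0 (ltr0n _ 3))) h := sumK.
have KN : \forall n \near \oo, (K <= N n)%N := Noo _ (nbhs_infty_ge K).
near=> n; have NK : (K <= N n)%N by near: n; exact: KN.
have := tail_halves (uC n) NK; have := vtail K.
have : `|\sum_(a < K) v a - \sum_(a < K) u n a| < e / 3.
  by near: n; exact: h.
move: KE; rewrite !ltr_norml !ler_norml.
set s := limn _; set s1 := \sum_(a < K) v a; set s2 := \sum_(a < K) _.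
set s3 := \sum_(a < N n) _; set g := 2 * C * _.
move=> ? /andP[? ?] /andP[? ?] /andP[? ?]; apply/andP; split; lra.
Unshelve. all: by end_near. Qed.

(** Both sides of the squeeze come from [1 + z <= expR z]: with [z = - x] for the upper bound, and
    with [z = x / (1 - x)], where [1 + z = (1 - x)^-1], for the lower one. *)
Lemma cvg_one_subX (x : nat -> R) (N : nat -> nat) (y : R) :
  (forall n, 0 <= x n < 1) -> x n @[n --> \oo] --> 0 ->
  (N n)%:R * x n @[n --> \oo] --> y ->
  (1 - x n) ^+ N n @[n --> \oo] --> expR (- y).
Proof.
move=> x01 x0 Nxy.
have lower n : expR (- ((N n)%:R * x n / (1 - x n))) <= (1 - x n) ^+ N n.
  have /andP[xn0 xn1] := x01 n; have x1 : 0 < 1 - x n by rewrite subr_gt0.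
  rewrite expRN -[X in _ <= X]invrK lef_pV2 ?posrE ?expR_gt0 ?invr_gt0 ?exprn_gt0 //.
  rewrite -exprVn -mulrA expRM_natl.
  rewrite lerXn2r ?nnegrE ?invr_ge0 ?expR_ge0 ?(ltW x1) //.
  apply: le_trans (expR_ge1Dx _).
  by rewrite -[X in X <= _]mul1r ler_pdivrMr // mulrDl mul1r divfK ?gt_eqF // subrK.
have upper n : (1 - x n) ^+ N n <= expR (- ((N n)%:R * x n)).
  have /andP[xn0 xn1] := x01 n; have x1 : 0 < 1 - x n by rewrite subr_gt0.
  rewrite -mulrN expRM_natl lerXn2r ?nnegrE ?expR_ge0 ?(ltW x1) //.
  exact: expR_ge1Dx.
have upc : expR (- ((N n)%:R * x n)) @[n --> \oo] --> expR (- y).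
  apply: continuous_cvg; first exact: continuous_expR.
  exact: cvgN.
have loc : expR (- ((N n)%:R * x n / (1 - x n))) @[n --> \oo] --> expR (- y).
  apply: continuous_cvg; first exact: continuous_expR.
  apply: cvgN; rewrite -[X in _ --> X]divr1; apply: cvgM => //.
  apply: cvgV => //; rewrite -[X in _ --> X]subr0.
  by apply: cvgB => //; exact: cvg_cst.
apply: (squeeze_cvgr _ loc upc); near=> n.
by rewrite lower upper.
Unshelve. all: by end_near. Qed.

End Limits.

Lemma cvgn_infty_ge (m : nat -> nat) (A : nat) :
  m n @[n --> \oo] --> \oo -> \forall n \near \oo, (A <= m n)%N.
Proof. by move=> moo; exact: (moo _ (nbhs_infty_ge A)). Qed.

(** * The recentred corank law and its limit *)

Section PointwiseLimits.
Variables (R : realType) (q : R).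
Hypothesis q2 : 2 <= q.

Let q1 : 1 < q. Proof. by apply: lt_le_trans q2; rewrite ltr1n. Qed.
Let q0 : 0 < q. Proof. exact: lt_trans q1. Qed.
Let lnq0 : 0 < ln q. Proof. exact: ln_gt0. Qed.

Lemma qV_cvg0 (k : nat -> nat) :
  k n @[n --> \oo] --> \oo -> q ^- k n @[n --> \oo] --> (0 : R).
Proof.
move=> koo; apply: (cvg_comp k (fun n => q ^- n) koo).
rewrite (_ : (fun n => q ^- n) = GRing.exp q^-1); last first.
  by apply/funext => n; rewrite exprVn.
by apply: cvg_expr; rewrite ger0_norm ?invr_ge0 ?(ltW q0) // invf_lt1.
Qed.

Lemma qprod_cvg_comp (k : nat -> nat) :
  k n @[n --> \oo] --> \oo -> qprod q (k n) @[n --> \oo] --> qprod_infty q.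
Proof. by move=> koo; apply: (cvg_comp k (qprod q) koo); exact: qprod_cvg. Qed.

Lemma qV_bin2_le (a : nat) : q ^- 'C(a, 2) <= 2 * 2 ^- a.
Proof.
rewrite ler_pdivlMr ?exprn_gt0 // mulrC ler_pdivrMr ?exprn_gt0 //.
have aC : (a <= 'C(a, 2).+1)%N by case: a => // a; rewrite binS bin1 ltnS leq_addl.
apply: (@le_trans _ _ (2 ^+ 'C(a, 2).+1)).
  by rewrite ler_weXn2l // ler1n.
by rewrite exprS ler_pM2l // lerXn2r ?nnegrE // ltW.
Qed.

(** In term [a] of [corank_massE] the eigenvalue is raised to the power [N n], and
    [N n * q ^- (m n - a).+1] tends to [kappa * q ^+ a / q]. *)
Lemma corank_mass_cvg (N m : nat -> nat) (kappa : R) :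
  m n @[n --> \oo] --> \oo ->
  (N n)%:R * q ^- m n @[n --> \oo] --> kappa ->
  corank_mass q (N n) (m n) @[n --> \oo] -->
  (qprod_infty q)^-1 * limn (series (fun a : nat =>
    expR (- (kappa * q ^+ a / q)) * ((-1) ^+ a * q ^- 'C(a, 2) / qprod q a))).
Proof.
move=> moo Nk; have Q0 := qprod_infty_gt0 q2.
have qp n : 0 < qprod q n by exact: qprod_gt0.
(* The factor cancels the limit of [qprod q (m n - a)] in [mass_coef], leaving [(qprod_infty q)^-1]
   outside as in [calL_pmf]. *)
pose u n a := qprod_infty q *
  ((1 - q ^- (m n - a).+1) ^+ N n * mass_coef q (m n) a).
rewrite (_ : (fun n => corank_mass q (N n) (m n)) =
    fun n => (qprod_infty q)^-1 * \sum_(a < (m n).+1) u n a); last first.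
  by apply/funext => n; rewrite -mulr_sumr mulKf ?gt_eqF // corank_massE.
(* [32 = 2 * 16]: the 2 comes from [qV_bin2_le], and 16 bounds the inverse of two [qprod] factors,
   each at least [1/4]. *)
apply: cvgMl_tmp; apply: (@tannery _ _ _ (qprod_infty q * 32)); first last.
- by apply/cvgnyPge => A; apply: filterS (cvgn_infty_ge A moo) => n; exact: leqW.
- move=> n a; rewrite /u /mass_coef !normrM !normfV !normrM.
  rewrite (ger0_norm (ltW Q0)) -!mulrA ler_wpM2l ?(ltW Q0) //.
  rewrite [X in _ * (X * _)]normrX normrN1 expr1n mul1r.
  have x0 : 0 <= 1 - q ^- (m n - a).+1 := ltW (one_sub_qV_gt0 q2 _).
  rewrite (ger0_norm (exprn_ge0 _ x0)) (ger0_norm (exprn_ge0 _ (ltW q0))).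
  rewrite !(ger0_norm (ltW (qp _))).
  apply: (@le_trans _ _ (1 * (2 * 2 ^- a * 16))); last by rewrite mul1r; lra.
  have qq0 : 0 <= (qprod q a * qprod q (m n - a))^-1.
    by rewrite invr_ge0 mulr_ge0 // ltW.
  rewrite ler_pM ?exprn_ge0 ?mulr_ge0 ?qV_ge0 //.
    by rewrite exprn_ile1 // gerBl qV_ge0.
  rewrite ler_pM ?qV_ge0 ?qV_bin2_le //.
  rewrite -[16]invrK lef_pV2 ?posrE ?mulr_gt0 ?invr_gt0 //.
  apply: (@le_trans _ _ (4^-1 * 4^-1)); first by lra.
  by rewrite ler_pM // qprod_ge.
move=> a; rewrite /u.
have ma : (m n - a)%N @[n --> \oo] --> \oo.
  apply/cvgnyPge => A; apply: filterS (cvgn_infty_ge (A + a) moo) => n.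
  by rewrite /= => h; rewrite leq_subRL ?(leq_trans _ h) ?leq_addl // addnC.
have am := cvgn_infty_ge a moo.
set e := expR _; set c := _ / qprod q a.
have -> : e * c = qprod_infty q * (e * (c / qprod_infty q)).
  by field; rewrite gt_eqF.
apply: cvgMl_tmp; apply: cvgM; last first.
  rewrite /mass_coef; under eq_fun do rewrite invfM mulrA.
  apply: cvgMl_tmp; apply: cvgV; rewrite ?gt_eqF //; exact: qprod_cvg_comp.
apply: cvg_one_subX.
- by move=> n; rewrite qV_ge0 //= -subr_gt0 one_sub_qV_gt0.
- apply: (@qV_cvg0 (fun n => (m n - a).+1)).
  by apply/cvgnyPge => A; apply: filterS (cvgn_infty_ge A ma) => n; exact: leqW.
rewrite -mulrA; have Nk' : (N n)%:R * q ^- m n * (q ^+ a / q) @[n --> \oo] -->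
    kappa * (q ^+ a / q) by apply: cvgMr_tmp.
apply: (cvg_trans _ Nk'); apply: near_eq_cvg.
near=> n; have h : (a <= m n)%N by near: n.
by rewrite -[in LHS](subnK h) exprD exprS; field; rewrite !expf_neq0 ?gt_eqF.
Unshelve. all: by end_near. Qed.

Lemma logb_cvg_infty (r : nat -> nat) (A : nat) : r @ \oo --> \oo ->
  \forall n \near \oo, A%:R <= logb q (r n)%:R.
Proof.
move=> roo; apply: filterS (cvgn_infty_ge (Num.truncn (q ^+ A)).+1 roo) => n h.
 rewrite /logb ler_pdivlMr // mulr_natl -lnXn //.
have rA : q ^+ A <= (r n)%:R.
  apply: le_trans (ltW (truncnS_gt _)) _; by rewrite ler_nat.
by rewrite ler_ln ?posrE ?exprn_gt0 // (lt_le_trans _ rA) ?exprn_gt0.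
Qed.

Lemma powR_logb (n : nat) : (0 < n)%N -> q `^ logb q n%:R = n%:R.
Proof.
move=> n0; rewrite /powR gt_eqF // /logb divfK ?gt_eqF // lnK //.
by rewrite posrE ltr0n.
Qed.

Lemma powRqD (x y : R) : q `^ (x + y) = q `^ x * q `^ y.
Proof. by rewrite powRD // (gt_eqF q0) implybT. Qed.

(** Extension by zero, so that [a n + x] is a legitimate argument for every integer [x] and every
    [n]. *)
Definition imass (n : nat) (z : int) : R :=
  if z is Posz m then corank_mass q n m else 0.

Lemma int_cvg_ge (r : nat -> nat) (a : nat -> int) (zeta : R) (x : int) :
  r @ \oo --> \oo ->
  (a n)%:~R - logb q (r n)%:R @[n --> \oo] --> zeta ->
  \forall n \near \oo, (x <= a n)%R.
Proof.
move=> roo az; pose A := `|Num.ceil (x%:~R - zeta + 1)|%N.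
have rA := logb_cvg_infty A roo.
move/cvgrPdist_lt : az => /(_ _ ltr01) az.
near=> n.
have h1 : A%:R <= logb q (r n)%:R by near: n.
have : `|zeta - ((a n)%:~R - logb q (r n)%:R)| < 1 by near: n.
have h2 : x%:~R - zeta + 1 <= A%:R :> R.
  rewrite (le_trans (ceil_ge _)) // /A -[leRHS]/((`|_|%N : int)%:~R).
  by rewrite ler_int abszE ler_norm.
rewrite ltr_norml => /andP[h3 h4].
rewrite -(@ler_int R); lra.
Unshelve. all: by end_near. Qed.

Lemma imass_cvg (r : nat -> nat) (a : nat -> int) (zeta : R) (x : int) :
  (\forall n \near \oo, (0 < r n)%N) -> r @ \oo --> \oo ->
  (a n)%:~R - logb q (r n)%:R @[n --> \oo] --> zeta ->
  imass (r n) (a n + x) @[n --> \oo] --> calL_pmf q (q `^ (- 1 - zeta)) x.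
Proof.
move=> r0 roo az; pose m n := absz (a n + x).
have mE : \forall n \near \oo, a n + x = Posz (m n).
  have := int_cvg_ge (- x) roo az; apply: filterS => n h.
  by rewrite /m gez0_abs // -lerBlDr sub0r.
have moo : m n @[n --> \oo] --> \oo.
  apply/cvgnyPge => A; have := int_cvg_ge (A%:Z - x) roo az.
  apply: filter_app; apply: filterS mE => n mn.
  by rewrite lerBlDr mn.
pose kappa := q `^ (- zeta - x%:~R).
apply: (@cvg_trans _ (corank_mass q (r n) (m n) @[n --> \oo])).
  by apply: near_eq_cvg; apply: filterS mE => n mn; rewrite mn.
have -> : calL_pmf q (q `^ (- 1 - zeta)) x =
  (qprod_infty q)^-1 * limn (series (fun a : nat =>
    expR (- (kappa * q ^+ a / q)) * ((-1) ^+ a * q ^- 'C(a, 2) / qprod q a))).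
  rewrite /calL_pmf; congr (_ * _); congr (limn _); congr series; apply/funext => b.
  congr (expR _ * _); rewrite mulNr; congr (- _).
  rewrite -powR_mulrn ?(ltW q0) // -powR_intmul ?(ltW q0) //.
  rewrite -(powR_inv1 (ltW q0)).
  rewrite /kappa -!powRqD.
  by congr (_ `^ _); rewrite rmorphB /=; ring.
apply: corank_mass_cvg => //.
apply: (@cvg_trans _ (q `^ (- ((a n)%:~R - logb q (r n)%:R) - x%:~R) @[n --> \oo])).
  apply: near_eq_cvg; near=> n.
  have rn : (0 < r n)%N by near: n.
  have mn : a n + x = Posz (m n) by near: n.
  rewrite -[in RHS](powR_logb rn) -powR_mulrn ?(ltW q0) // -powRN -powRqD.
  congr (_ `^ _).
  have -> : (m n)%:R = (a n)%:~R + x%:~R :> R by rewrite -rmorphD /= mn.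
  by ring.
rewrite /kappa /powR gt_eqF //; apply: continuous_cvg; first exact: continuous_expR.
apply: cvgMr_tmp; apply: cvgB; last exact: cvg_cst.
exact: cvgN.
Unshelve. all: by end_near. Qed.

End PointwiseLimits.

(** * Rounding of logarithms, and limits of the corank law of a uniform matrix *)

Section RhoLimits.
Variables (R : realType) (q : R).
Hypothesis q2 : 2 <= q.

Let q1 : 1 < q. Proof. by apply: lt_le_trans q2; rewrite ltr1n. Qed.
Let q0 : 0 < q. Proof. exact: lt_trans q1. Qed.

(** Once the fractional part is within [1/2] of [zeta], on either side, the rounded value is exactly
    [- floor (- l n)], and the difference with [l n] is the fractional part itself. *)
Lemma nearest_int_cvg (l : nat -> R) (zeta : R) :
  frac_part (- l n) @[n --> \oo] --> zeta ->
  (nearest_int (l n + zeta))%:~R - l n @[n --> \oo] --> zeta.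
Proof.
move=> fz; apply: (cvg_trans _ fz); apply: near_eq_cvg.
move/cvgrPdist_lt: fz => /(_ _ (divr_gt0 ltr01 (ltr0n _ 2))) fz.
near=> n.
have : `|zeta - frac_part (- l n)| < 1 / 2 by near: n; exact: fz.
rewrite ltr_norml /frac_part /nearest_int => /andP[h1 h2].
have -> : Num.floor (l n + zeta + 2^-1) = - Num.floor (- l n).
  by apply: floor_def; rewrite rmorphD rmorphN /=; apply/andP; split; lra.
by rewrite rmorphN /= addrC.
Unshelve. all: by end_near. Qed.

(** The [k] rows are dependent with probability at most the sum of [q ^- (z + i)] for [1 <= i <= k],
    a geometric sum controlled by [2 <= q]. The factor [1 - q ^- k] leaves room for the next term in
    the induction. *)
Lemma rho_full_rank (k z : nat) : 1 - rho q k (k + z) z <= q ^- z * (1 - q ^- k).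
Proof.
elim: k => [|k IH].
  by rewrite /= add0n eqxx expr0 invr1 !subrr mulr0.
rewrite addSn /=; have a0 := qV_ge0 q2 (k + z).+1; have a1 := qV_le1 q2 (k + z).+1.
have r0 := rho_ge0 q2 k (k + z).+1 z.
have E : q ^- (k + z).+1 = q ^- z * q ^- k * q^-1.
  by rewrite exprS exprD !invfM; ring.
have E' : q ^- k.+1 = q ^- k * q^-1 by rewrite exprS invfM mulrC.
have z0 := qV_ge0 q2 z; have k0 := qV_ge0 q2 k.
have qV : q^-1 <= 2^-1 by rewrite lef_pV2 ?posrE.
have h : q ^- z * q ^- k * q^-1 <= q ^- z * q ^- k * 2^-1.
  by rewrite ler_wpM2l // mulr_ge0.
have := rho_le1 q2 k (k + z) z.
move: IH a0 a1 r0; rewrite E' E; move: (rho q k (k + z) z) (rho q k (k + z).+1 z).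
move: (q ^- z) (q ^- k) z0 k0 h => Z K z0 k0 h x y IH a0 a1 y0 xle1.
set w := Z * K * q^-1 in h a0 a1 *.
have -> : Z * (1 - K * q^-1) = Z - w by rewrite mulrBr mulr1 mulrA.
have x1 : 0 <= 1 - x by rewrite subr_ge0 xle1.
have wx : 0 <= w * (1 - x) by rewrite mulr_ge0.
have wy : 0 <= w * y by rewrite mulr_ge0.
lra.
Qed.

(* Pairs with [k < 0] or [m < 0] have mass 0; the value there is chosen so that
   [irho_dist] holds without side conditions. *)
Definition irho (k m z : int) : R :=
  match k, m with
  | Posz k', Posz m' => if z is Posz b then rho q k' m' b else 0
  | _, _ => (m - k == z)%:R
  end.

Lemma irho_ge0 (k m z : int) : 0 <= irho k m z.
Proof. by case: k m z => [k|k] [m|m] [z|z] //=; exact: rho_ge0. Qed.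

Lemma irho_le1 (k m z : int) : irho k m z <= 1.
Proof.
case: k m z => [k|k] [m|m] [z|z] //=; try exact: rho_le1; by case: (_ == _).
Qed.

(** The error is uniform in [k] and [m]. Corank [b] is impossible for [m > k + b], means full row
    rank for [m = k + b], and is bounded by [rho_upper] for [m < k + b]; the 4 is the inverse of the
    lower bound of [qprod]. *)
Lemma irho_dist (k m : int) (b : nat) :
  `|irho k m b - (m - k == b)%:R| <= 4 * q ^- b.
Proof.
have b0 := qV_ge0 q2 b.
case: k m => [k|k] [m|m] /=; try by rewrite subrr normr0 mulr_ge0.
have -> : (m%:Z - k%:Z == b%:Z) = (m == k + b)%N.
  by rewrite subr_eq -PoszD eqz_nat addnC.
have [kb|kb|->] := ltngtP m (k + b)%N.
- rewrite subr0 ger0_norm ?rho_ge0 //; apply: le_trans (rho_upper q2 kb) _.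
  rewrite mulrC ler_wpM2r // -[4]invrK lef_pV2 ?posrE ?invr_gt0 ?qprod_gt0 //.
  exact: qprod_ge.
- by rewrite subr0 rho_gt // normr0 mulr_ge0.
- rewrite distrC ger0_norm ?subr_ge0 ?rho_le1 //.
  apply: le_trans (rho_full_rank _ _) _.
  rewrite mulrC ler_wpM2r //; have := qV_ge0 q2 k; lra.
Qed.

Lemma irho_cvg_indic (k m z : nat -> int) (e : bool) :
  (forall n, (m n - k n == z n) = e) ->
  (forall A : int, \forall n \near \oo, A <= z n) ->
  irho (k n) (m n) (z n) @[n --> \oo] --> (e%:R : R).
Proof.
move=> eE zoo; pose y n := absz (z n).
have zE : \forall n \near \oo, z n = Posz (y n).
  by apply: filterS (zoo 0) => n zn; rewrite /y gez0_abs.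
have yoo : y n @[n --> \oo] --> \oo.
  apply/cvgnyPge => A; apply: filter_app (zoo A); apply: filterS zE => n ->.
  by [].
have c0 : 4 * q ^- y n @[n --> \oo] --> (0 : R).
  by rewrite -[X in _ --> X](mulr0 4); apply: cvgMl_tmp; exact: qV_cvg0.
apply/cvgrPdist_le => eps eps0; move/cvgrPdist_le : c0 => /(_ _ eps0).
apply: filter_app; apply: filterS zE => n zn.
rewrite sub0r normrN ger0_norm ?mulr_ge0 ?qV_ge0 //; apply: le_trans.
by rewrite distrC -(eE n) zn; exact: irho_dist.
Qed.

(* The law of [max 0 (- c) + J_|c|]. *)
Definition limit_pmf (c : int) (y : nat) : R :=
  if c + y%:Z is Posz u then
    q ^- (y * u) * qprod_infty q / (qprod q y * qprod q u)
  else 0.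

Lemma irho_cvg_limit (k m : nat -> int) (c : int) (y : nat) :
  (forall n, k n - m n = c) ->
  (forall A : int, \forall n \near \oo, A <= m n) ->
  irho (k n) (m n) y @[n --> \oo] --> limit_pmf c y.
Proof.
move=> kmc moo; rewrite /limit_pmf.
have Q0 := qprod_infty_gt0 q2.
case cy : (c + y%:Z) => [u|u]; last first.
  apply: (@cvg_trans _ ((fun=> 0 : R) @ \oo)); last exact: cvg_cst.
  apply: near_eq_cvg.
  have mc := moo `|c|.
  near=> n; have m0 : `|c| <= m n by near: n.
  have kE : k n = c + m n by rewrite -(kmc n) subrK.
  have : 0 <= k n by rewrite kE; lia.
  case Ek : (k n) kE => [k'|//] kE _.
  case Em : (m n) m0 kE => [m'|] m0 kE /=; last by lia.
  by rewrite rho_gt //; lia.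
(* In the notation of [rho_closed], [x n] is the rank and [u = c + y] the corank on the other side;
   only [x n] varies, and it tends to infinity. *)
pose x n := absz (m n - y%:Z).
have xE : \forall n \near \oo, m n = Posz (y + x n) /\ k n = Posz (x n + u).
  apply: filterS (moo (y%:Z)) => n mn.
  by have := kmc n; rewrite /x; split; lia.
have xoo : x n @[n --> \oo] --> \oo.
  apply/cvgnyPge => A; apply: filter_app (moo (A + y)%:Z).
  by apply: filterS xE => n [mn _] ; rewrite mn; lia.
apply: (@cvg_trans _ (q ^- (y * u) * (qprod q (y + x n) * qprod q (x n + u)) /
  (qprod q y * qprod q u * qprod q (x n)) @[n --> \oo])).
  by apply: near_eq_cvg; apply: filterS xE => n [-> ->] /=; rewrite rho_closed.
have -> : q ^- (y * u) * qprod_infty q / (qprod q y * qprod q u) =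
   q ^- (y * u) * (qprod_infty q * qprod_infty q) /
   (qprod q y * qprod q u * qprod_infty q).
  by field; rewrite !gt_eqF ?qprod_gt0 // exprn_gt0.
apply: cvgM.
  apply: cvgMl_tmp; apply: cvgM; apply: qprod_cvg_comp => //.
    apply/cvgnyPge => A; apply: filterS (cvgn_infty_ge A xoo) => n h.
    exact: leq_trans h (leq_addl _ _).
  apply/cvgnyPge => A; apply: filterS (cvgn_infty_ge A xoo) => n h.
  exact: leq_trans h (leq_addr _ _).
apply: cvgV; first by rewrite !mulf_neq0 // gt_eqF // qprod_gt0.
by apply: cvgMl_tmp; exact: qprod_cvg_comp.
Unshelve. all: by end_near. Qed.

End RhoLimits.

(** * Convergence of discrete laws *)

Section MeanOf.
Variable R : realType.

(* [I] is the mean of [h] for the weights [w], up to the mass not carried by [w]. *)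
Definition mean_of (S : eqType) (w h : S -> R) (I : R) : Prop :=
  forall l, uniq l -> \sum_(s <- l) w s * h s <= I /\
                      \sum_(s <- l) w s * (1 - h s) <= 1 - I.

(* Only the total mass of the limit weights matters: no mass can escape. *)
Lemma mean_of_cvg (S : eqType) (wn hn : nat -> S -> R) (In : nat -> R)
    (w h : S -> R) (I : R) :
  (forall n, mean_of (wn n) (hn n) (In n)) -> mean_of w h I ->
  (forall s, wn n s @[n --> \oo] --> w s) ->
  (forall s, hn n s @[n --> \oo] --> h s) ->
  (forall e, 0 < e -> exists2 l, uniq l & 1 - e <= \sum_(s <- l) w s) ->
  In n @[n --> \oo] --> I.
Proof.
move=> Mn M wc hc tight; apply/cvgrPdist_lt => e e0.
have e2 : 0 < e / 2 by rewrite divr_gt0.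
have [l ul lE] := tight _ e2; have [MA MB] := M l ul.
have cA : \sum_(s <- l) wn n s * hn n s @[n --> \oo] --> \sum_(s <- l) w s * h s.
  by apply: cvgn_sum => s; exact: cvgM.
have cB : \sum_(s <- l) wn n s * (1 - hn n s) @[n --> \oo] -->
    \sum_(s <- l) w s * (1 - h s).
  by apply: cvgn_sum => s; apply: cvgM => //; apply: cvgB => //; exact: cvg_cst.
move: cA cB => /cvgrPdist_lt/(_ _ e2) cA /cvgrPdist_lt/(_ _ e2) cB.
(* The two finite sums bound [I] and [1 - I] from below and add up to at least [1 - e / 2]; hence
   each is within [e / 2] of what it bounds. *)
have AB : \sum_(s <- l) w s * h s + \sum_(s <- l) w s * (1 - h s) =
    \sum_(s <- l) w s.
  by rewrite -big_split; apply: eq_bigr => s _ /=; ring.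
near=> n; have [An Bn] := Mn n l ul.
have : `|\sum_(s <- l) w s * h s - \sum_(s <- l) wn n s * hn n s| < e / 2.
  by near: n.
have : `|\sum_(s <- l) w s * (1 - h s) - \sum_(s <- l) wn n s * (1 - hn n s)| < e / 2.
  by near: n.
rewrite !ltr_norml => /andP[_ b2] /andP[_ a2].
by apply/andP; split; lra.
Unshelve. all: by end_near. Qed.

Lemma ler_sum_uniq (S : eqType) (f : S -> R) (l1 l2 : seq S) :
  uniq l1 -> uniq l2 -> (forall s, 0 <= f s) -> (forall s, s \notin l2 -> f s = 0) ->
  \sum_(s <- l1) f s <= \sum_(s <- l2) f s.
Proof.
move=> u1 u2 f0 fl2.
have -> : \sum_(s <- l1) f s = \sum_(s <- l1 | s \in l2) f s.
  rewrite [RHS]big_mkcond /=; apply: eq_bigr => s _.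
  by case: ifPn => // /fl2.
rewrite -big_filter (perm_big [seq s <- l2 | s \in l1]).
  by rewrite big_filter big_mkcond ler_sum // => s _; case: ifP.
apply: uniq_perm; rewrite ?filter_uniq // => s.
by rewrite !mem_filter andbC.
Qed.

Variables (q : R).
Hypothesis q2 : 2 <= q.

Lemma imass_ge0 (n : nat) (z : int) : 0 <= imass q n z.
Proof. by case: z => // m; exact: corank_mass_ge0. Qed.

Lemma corank_mean2E (f : nat -> nat -> R) (r t : nat) :
  corank_mean q r (fun m => corank_mean q t (f m)) =
  \sum_(x <- [seq (m, k) | m <- iota 0 r.+1, k <- iota 0 t.+1])
     corank_mass q r x.1 * corank_mass q t x.2 * f x.1 x.2.
Proof.
rewrite corank_mean_mass big_allpairs.
rewrite -(big_mkord xpredT (fun m => corank_mass q r m * corank_mean q t (f m))).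
rewrite /index_iota subn0; apply: eq_bigr => m _.
rewrite corank_mean_mass -(big_mkord xpredT (fun k => corank_mass q t k * f m k)).
rewrite mulr_sumr /index_iota subn0; apply: eq_bigr => k _; by rewrite mulrA.
Qed.

(** The law of the Betti number in coordinates shifted by [a] and [b], in which pointwise limits
    exist. Reindexing a finite list by the shift is injective, and the exact mean dominates every
    partial sum, both for [irho] and for [1 - irho]. *)
Lemma imass_mean_of (r t : nat) (a b z : int) :
  mean_of (fun s : int * int => imass q r (a + s.1) * imass q t (b + s.2))
    (fun s => irho q (b + s.2) (a + s.1) z)
    (if z is Posz y then
       corank_mean q r (fun m => corank_mean q t (fun k => rho q k m y))
     else 0).
Proof.
pose L := [seq (m, k) | m <- iota 0 r.+1, k <- iota 0 t.+1].
pose iL := [seq (Posz x.1, Posz x.2) | x <- L].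
have uL : uniq iL.
  rewrite map_inj_uniq; last by move=> [x1 x2] [y1 y2] [-> ->].
  by apply: allpairs_uniq; rewrite ?iota_uniq // => -[x1 x2] [y1 y2].
have out (x : int * int) : x \notin iL -> imass q r x.1 * imass q t x.2 = 0.
  case: x => -[m|m] [k|k] /=; rewrite ?(mul0r, mulr0) // => mk.
  have [rm|mr] := ltnP r m; first by rewrite corank_mass_gt ?mul0r.
  have [tk|kt] := ltnP t k; first by rewrite [corank_mass q t k]corank_mass_gt ?mulr0.
  case/negP: mk; apply/mapP; exists (m, k) => //.
  by apply/allpairsP; exists (m, k); rewrite !mem_iota /= !ltnS.
have key (g : int -> int -> R) l : uniq l -> (forall x y, 0 <= g x y) ->
    \sum_(s <- l) imass q r (a + s.1) * imass q t (b + s.2) * g (a + s.1) (b + s.2)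
    <= corank_mean q r (fun m => corank_mean q t (fun k => g m k)).
  move=> ul g0; rewrite (corank_mean2E (fun m k => g m k)).
  have -> : \sum_(x <- L) corank_mass q r x.1 * corank_mass q t x.2 * g x.1 x.2 =
      \sum_(x <- iL) imass q r x.1 * imass q t x.2 * g x.1 x.2 by rewrite big_map.
  pose phi (s : int * int) := (a + s.1, b + s.2).
  have -> : \sum_(s <- l) imass q r (a + s.1) * imass q t (b + s.2) *
       g (a + s.1) (b + s.2) =
     \sum_(x <- map phi l) imass q r x.1 * imass q t x.2 * g x.1 x.2 by rewrite big_map.
  apply: ler_sum_uniq => //.
  - by rewrite map_inj_uniq // => -[x1 x2] [y1 y2] [/addrI-> /addrI->].
  - by move=> x; rewrite !mulr_ge0 ?imass_ge0.
  - by move=> x /out ->; rewrite mul0r.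
move=> l ul; split.
  apply: le_trans (key (fun x y => irho q y x z) l ul _) _.
    by move=> x y; exact: irho_ge0.
  case: z => [y|y] /=; first by [].
  by rewrite (@eq_corank_mean _ _ _ _ (fun=> 0)) ?corank_mean_cst // => m _; rewrite corank_mean_cst.
apply: le_trans (key (fun x y => 1 - irho q y x z) l ul _) _.
  by move=> x y; rewrite subr_ge0; exact: irho_le1.
case: z => [y|y] /=.
  by rewrite (@eq_corank_mean _ _ _ _ _ 
    (fun m _ => corank_mean1B q t (fun k => rho q k m y))) corank_mean1B.
by rewrite !subr0 (@eq_corank_mean _ _ _ _ (fun=> 1)) ?corank_mean_cst // => m _; rewrite corank_mean_cst.
Qed.

End MeanOf.

(** * Mixtures and tightness of discrete laws *)

Section DiscreteLimits.
Context d (T : measurableType d) (R : realType) (P : probability T R).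

Lemma discrete_rv_comp (S S' : Type) (X : T -> S) (f : S -> S') :
  discrete_rv X -> discrete_rv (fun w => f (X w)).
Proof. by move=> mX A; exact: (mX (f @^-1` A)). Qed.

Lemma discrete_rv_mixture (S : countType) (S' : Type) (X : T -> S)
    (Y : S -> T -> S') :
  discrete_rv X -> (forall s, discrete_rv (Y s)) ->
  discrete_rv (fun w => Y (X w) w).
Proof.
move=> mX mY A.
have -> : (fun w => Y (X w) w) @^-1` A = \bigcup_n
    (if unpickle n is Some s then X @^-1` [set s] `&` Y s @^-1` A else set0).
  apply/seteqP; split=> [w Aw|w [n _]].
    by exists (pickle (X w)) => //; rewrite pickleK.
  by case: (unpickle n) => // s [/= ->].
apply: bigcupT_measurable => n; case: (unpickle n) => // s.
by apply: measurableI; [exact: mX|exact: mY].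
Qed.

Lemma discrete_rv_pair (S : countType) (S' : Type) (X : T -> S) (Y : T -> S') :
  discrete_rv X -> discrete_rv Y -> discrete_rv (fun w => (X w, Y w)).
Proof.
move=> mX mY; apply: (@discrete_rv_mixture S _ X (fun s w => (s, Y w))) => // s.
exact: (discrete_rv_comp (pair s) mY).
Qed.

Lemma fine_prob_le (A B : set T) : measurable A -> measurable B -> A `<=` B ->
  fine (P A) <= fine (P B).
Proof. by move=> mA mB AB; rewrite -lee_fin !prob_fineK // le_measure ?inE. Qed.

Lemma fine_probC (A : set T) : measurable A -> fine (P (~` A)) = 1 - fine (P A).
Proof.
move=> mA; rewrite probability_setC // -(prob_fineK P mA) /=.
by [].
Qed.

Lemma mean_of_prob (S : eqType) (X : T -> S) (G : set S) : discrete_rv X ->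
  mean_of (fun s => fine (P (X @^-1` [set s]))) (fun s => `[< G s >]%:R)
    (fine (P (X @^-1` G))).
Proof.
move=> mX; have key (H : set S) l : uniq l ->
    \sum_(s <- l) fine (P (X @^-1` [set s])) * `[< H s >]%:R <=
    fine (P (X @^-1` H)).
  move=> ul; rewrite -lee_fin prob_fineK; last exact: mX.
  under eq_bigr do rewrite mulrC.
  have mH : measurable [set w | X w \in l /\ H (X w)].
    exact: (mX [set s | s \in l /\ H s]).
  rewrite -(prob_seq _ H mX ul); apply: le_measure.
  - exact: mem_set.
  - by apply: mem_set; exact: mX.
  - by move=> w [].
move=> l ul; split; first exact: key.
rewrite -fine_probC; last exact: mX.
rewrite preimage_setC; apply: le_trans (key (~` G) l ul).
apply: ler_sum => s _; rewrite ler_wpM2l ?fine_ge0 //.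
by case: asboolP => Gs; case: asboolP => Gs' //=; rewrite ?subrr ?subr0.
Qed.

Lemma tight_discrete_rv (S : countType) (X : T -> S) (e : R) :
  discrete_rv X -> 0 < e ->
  exists2 l, uniq l & 1 - e <= \sum_(s <- l) fine (P (X @^-1` [set s])).
Proof.
move=> mX e0; pose l k : seq S := undup (pmap unpickle (iota 0 k)).
have lP k w : X w \in l k <-> exists2 i, (i < k)%N & unpickle i = Some (X w).
  rewrite mem_undup mem_pmap; split.
    by move=> /mapP[i]; rewrite mem_iota /= => ik E; exists i.
  by move=> [i ik E]; apply/mapP; exists i; rewrite ?mem_iota.
pose E k := [set w | X w \in l k].
have mE k : measurable (E k) by exact: (mX [set s | s \in l k]).
have EU : \bigcup_k E k = setT.
  apply/seteqP; split=> w // _; exists (pickle (X w)).+1 => //.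
  by apply/lP; exists (pickle (X w)); rewrite // pickleK.
have PU : P (\bigcup_k E k) = 1%:E by rewrite EU; exact: probability_setT.
have cE := @nondecreasing_cvg_mu _ _ _ P E mE (bigcupT_measurable _ mE).
have /fine_cvgP[_ /cvgrPdist_le/(_ _ e0)[k _ /(_ k (leqnn k)) /= h]] :
    (P \o E) n @[n --> \oo] --> 1%:E.
  rewrite -PU; apply: cE => m n mn; apply/subsetPset => w /lP[i im iE]; apply/lP.
  by exists i => //; exact: leq_trans im mn.
exists (l k); first exact: undup_uniq.
have := prob_seq P setT mX (undup_uniq (pmap unpickle (iota 0 k))).
rewrite -/(l k) (_ : [set w | X w \in l k /\ setT (X w)] = E k); last first.
  by apply/seteqP; split=> [w []|w].
move=> PE; move: h; rewrite PE /= => h.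
rewrite (eq_bigr (fun s => `[< [set: S] s >]%:R * fine (P (X @^-1` [set s])))).
  by move: h; rewrite ler_norml => /andP[_]; lra.
by move=> s _; rewrite asboolT // mul1r.
Qed.

(* Finite sums over the values of [X] are grouped by the value of [g X], which is
   all that the family [Y] is independent of. *)
Lemma mixture_le (S : eqType) (U : countType) (S' : Type) (X : T -> S) (g : S -> U)
    (Y : U -> T -> S') (B : set S') (l : seq S) :
  discrete_rv X -> (forall u, discrete_rv (Y u)) ->
  (forall u, independent_rv P (Y u) (fun w => g (X w))) -> uniq l ->
  \sum_(s <- l) fine (P (X @^-1` [set s])) * fine (P (Y (g s) @^-1` B)) <=
  fine (P ((fun w => Y (g (X w)) w) @^-1` B)).
Proof.
move=> mX mY indY ul; pose C w := g (X w).
have mC : discrete_rv C by exact: discrete_rv_comp.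
have mV : discrete_rv (fun w => Y (C w) w) by exact: discrete_rv_mixture.
pose lc := undup (map g l).
(* Recording the event as a Boolean makes [(C, v)] a discrete variable with values in an eqType, to
   which [prob_seq] applies although [S'] is an arbitrary type. *)
pose v w : bool := `[< B (Y (C w) w) >].
have mv : discrete_rv v by exact: (discrete_rv_comp (fun x => `[< B x >]) mV).
apply: (@le_trans _ _ (\sum_(c <- lc) fine (P (C @^-1` [set c])) *
    fine (P (Y c @^-1` B)))).
  have -> : \sum_(s <- l) fine (P (X @^-1` [set s])) * fine (P (Y (g s) @^-1` B)) =
      \sum_(c <- lc) (\sum_(s <- l) fine (P (X @^-1` [set s])) *
         `[< [set s | g s = c] s >]%:R) * fine (P (Y c @^-1` B)).
    under [RHS]eq_bigr do rewrite mulr_suml.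
    rewrite exchange_big /=; apply: eq_big_seq => s sl.
    rewrite (bigD1_seq (g s)) ?undup_uniq //=; last first.
      by rewrite mem_undup map_f.
    rewrite asboolT // mulr1 big1 ?addr0 // => c cg.
    by rewrite asboolF ?mulr0 ?mul0r // => /eqP; rewrite eq_sym (negPf cg).
  apply: ler_sum => c _; rewrite ler_wpM2r ?fine_ge0 //.
  by have [] := mean_of_prob [set s | g s = c] mX ul.
have mCv : discrete_rv (fun w => (C w, v w)) by exact: discrete_rv_pair.
pose lcv := [seq (c, true) | c <- lc].
have ucv : uniq lcv by rewrite map_inj_uniq ?undup_uniq // => x y [].
have := prob_seq P setT mCv ucv; rewrite big_map => E.
have -> : \sum_(c <- lc) fine (P (C @^-1` [set c])) * fine (P (Y c @^-1` B)) =
    fine (P [set w | (C w, v w) \in lcv /\ setT (C w, v w)]).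
  rewrite E /=; apply: eq_bigr => c _; rewrite asboolT // mul1r.
  rewrite -fineM ?(fin_num_measure P _ (mC _)) ?(fin_num_measure P _ (mY _ _)) //.
  congr (fine _); rewrite muleC -indY; congr (P _); apply/seteqP; split=> w /=.
    by move=> [Bw Cw]; rewrite /v /C Cw asboolT.
  by rewrite /v /C => -[Cw /asboolP]; rewrite Cw.
apply: fine_prob_le.
- exact: (mCv [set x | x \in lcv /\ setT x]).
- exact: mV.
- move=> w [/mapP[c _ [_ /asboolP]]] //.
Qed.

End DiscreteLimits.

Section DistributionLimits.
Context d (T : measurableType d) (R : realType) (P : probability T R).
Context d' (T' : measurableType d') (P' : probability T' R).

Lemma cvg_prob_discrete (S : countType) (X : nat -> T -> S) (Y : T' -> S) (A : set S) :
  (forall n, discrete_rv (X n)) -> discrete_rv Y ->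
  (forall s, fine (P (X n @^-1` [set s])) @[n --> \oo] -->
     fine (P' (Y @^-1` [set s]))) ->
  P (X n @^-1` A) @[n --> \oo] --> P' (Y @^-1` A).
Proof.
move=> mX mY XY; rewrite -[X in _ --> X]prob_fineK; last exact: mY.
apply/fine_cvgP; split.
  by apply: nearW => n; rewrite fin_num_measure //; exact: mX.
apply: mean_of_cvg (fun n => mean_of_prob P A (mX n)) (mean_of_prob P' A mY) XY _ _.
  by move=> s; exact: cvg_cst.
by move=> e e0; exact: tight_discrete_rv.
Qed.

Lemma cvg_in_distribution_int (X : nat -> T -> int) (Y : T' -> int) :
  (forall n, discrete_rv (X n)) -> discrete_rv Y ->
  (forall s, fine (P (X n @^-1` [set s])) @[n --> \oo] -->
     fine (P' (Y @^-1` [set s]))) ->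
  cvg_in_distribution P (fun n w => (X n w)%:~R : R) P' (fun w => (Y w)%:~R).
Proof.
move=> mX mY XY; split.
- by move=> n _ A _; rewrite setTI; exact: (mX n [set z | A z%:~R]).
- by move=> _ A _; rewrite setTI; exact: (mY [set z | A z%:~R]).
move=> x _; exact: (@cvg_prob_discrete _ X Y [set z | z%:~R <= x]).
Qed.

End DistributionLimits.

(** * Limits of persistent Betti numbers *)

Section BettiLimits.
Context d (T : measurableType d) (R : realType) (P : probability T R).
Variables (F : finFieldType) (L : nat -> nat -> T -> F).
Hypothesis hL : uniform_lower_triangular P L.
Notation q := (#|F|%:R : R).

Let q2 : 2 <= q. Proof. by rewrite ler_nat card_field_gt1. Qed.

Definition betti (r t : nat) (w : T) : nat :=
  persistent_betti (fun i j => L i j w) r (r + t).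

Lemma discrete_betti (r t : nat) : discrete_rv (betti r t).
Proof. exact: (discrete_persistent_betti hL). Qed.

Lemma prob_betti_int (r t : nat) (z : int) :
  fine (P [set w | (betti r t w)%:Z = z]) =
  if z is Posz y then
    corank_mean q r (fun m => corank_mean q t (fun k => rho q k m y))
  else 0.
Proof.
case: z => [y|y].
  have -> : [set w | (betti r t w)%:Z = Posz y] = [set w | betti r t w = y].
    by apply/seteqP; split=> w /= => [[]|->].
  by rewrite (prob_persistent_betti hL).
by rewrite (_ : [set w | _] = set0) ?measure0 //; apply/seteqP; split.
Qed.

Section Limit.
Variables (r t : nat -> nat) (a b : nat -> int).
Context d' (T' : measurableType d') (P' : probability T' R) (X Y : T' -> int).
Hypotheses (mX : discrete_rv X) (mY : discrete_rv Y).
Hypothesis indXY : independent_rv P' Y X.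
Hypothesis cvgX : forall i,
  imass q (r n) (a n + i) @[n --> \oo] --> fine (P' (X @^-1` [set i])).
Hypothesis cvgY : forall j,
  imass q (t n) (b n + j) @[n --> \oo] --> fine (P' (Y @^-1` [set j])).

Let XY w := (X w, Y w).
Let mXY : discrete_rv XY. Proof. exact: discrete_rv_pair. Qed.

Let fine_prob_pair (s : int * int) : fine (P' (XY @^-1` [set s])) =
  fine (P' (X @^-1` [set s.1])) * fine (P' (Y @^-1` [set s.2])).
Proof.
rewrite mulrC -fineM ?(fin_num_measure P' _ (mX _)) ?(fin_num_measure P' _ (mY _)) //.
rewrite -indXY; congr (fine (P' _)); apply/seteqP; split=> w.
  by case: s => i j [<- <-].
by case: s => i j [/= Yj Xi]; rewrite /XY /= Yj Xi.
Qed.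

(** The level [z n] may move with [n]: it follows [a n - b n] when the Betti number is recentred,
    and is constant when [a n - b n] is. *)
Let cvg_betti_point (z : nat -> int) (h : int * int -> R) (I : R) :
  mean_of (fun s => fine (P' (XY @^-1` [set s]))) h I ->
  (forall s, irho q (b n + s.2) (a n + s.1) (z n) @[n --> \oo] --> h s) ->
  fine (P [set w | (betti (r n) (t n) w)%:Z = z n]) @[n --> \oo] --> I.
Proof.
move=> hI hc; under eq_fun do rewrite prob_betti_int.
apply: mean_of_cvg (fun n => imass_mean_of q2 (r n) (t n) (a n) (b n) (z n)) hI _ hc _.
  by move=> s; rewrite fine_prob_pair; exact: cvgM.
by move=> e e0; exact: tight_discrete_rv.
Qed.

Lemma betti_cvg_difference :
  (forall A : int, \forall n \near \oo, A <= a n - b n) ->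
  cvg_in_distribution P
    (fun n w => (betti (r n) (t n) w)%:R - (a n - b n)%:~R)
    P' (fun w => (X w)%:~R - (Y w)%:~R).
Proof.
move=> aboo; pose Xn n w := (betti (r n) (t n) w)%:Z - (a n - b n).
have -> : (fun n w => (betti (r n) (t n) w)%:R - (a n - b n)%:~R : R) =
    (fun n w => (Xn n w)%:~R).
  by apply/funext => n; apply/funext => w; rewrite /Xn [RHS]rmorphB.
have -> : (fun w => (X w)%:~R - (Y w)%:~R : R) = (fun w => (X w - Y w)%:~R).
  by apply/funext => w; rewrite rmorphB.
apply: cvg_in_distribution_int.
- by move=> n; apply: (discrete_rv_comp (fun k : nat => k%:Z - _)); exact: discrete_betti.
- exact: (discrete_rv_comp (fun s => s.1 - s.2) mXY).
move=> y; rewrite /Xn.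
have -> : (fun n => fine (P ((fun w => (betti (r n) (t n) w)%:Z - (a n - b n))
      @^-1` [set y]))) =
    fun n => fine (P [set w | (betti (r n) (t n) w)%:Z = a n - b n + y]).
  apply/funext => n; congr (fine (P _)); apply/seteqP; split=> w /=; lia.
apply: (cvg_betti_point (mean_of_prob P' [set s : int * int | s.1 - s.2 = y] mXY)).
(* At fixed [(i, j)] the corank concentrates at [m - k = a n - b n + i - j], so the limit is the
   indicator of [i - j = y]. *)
move=> [i j] /=; apply: irho_cvg_indic => // [n|A].
  by apply/eqP/asboolP => /=; lia.
by apply: filterS (aboo (A - y)) => n; lia.
Qed.

Lemma betti_cvg_mixture (c0 : int) (C : T' -> int) (J : nat -> T' -> nat) :
  (forall n, b n = a n + c0) -> (forall w, C w = c0 + Y w - X w) ->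
  (forall A : int, \forall n \near \oo, A <= a n) ->
  (forall u, has_J_law q u P' (J u)) ->
  (forall u, independent_rv P' (J u) C) ->
  cvg_in_distribution P (fun n w => (betti (r n) (t n) w)%:R)
    P' (fun w => (Num.max 0 (- C w) + (J `|C w|%N w)%:Z)%:~R).
Proof.
move=> bE CE aoo Jlaw Jind.
have {CE}EC : C = fun w => c0 + Y w - X w by apply/funext.
subst C.
pose g (s : int * int) := c0 + s.2 - s.1.
pose W (c : int) w := Num.max 0 (- c) + (J `|c|%N w)%:Z.
have mW c : discrete_rv (W c).
  by apply: (discrete_rv_comp (fun k : nat => Num.max 0 (- c) + k%:Z)); case: (Jlaw `|c|%N).
have indW c : independent_rv P' (W c) (fun w => g (XY w)).
  move=> A B; exact: (Jind `|c|%N [set k | A (Num.max 0 (- c) + k%:Z)] B).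
have mV : discrete_rv (fun w => W (g (XY w)) w).
  apply: (discrete_rv_mixture (X := fun w => g (XY w)) (Y := W)) => //.
  exact: (discrete_rv_comp g mXY).
have W_pmf c (y : nat) : fine (P' (W c @^-1` [set y%:Z])) = limit_pmf q c y.
  have [c0'|c0'] := lerP 0 c.
    have [_ Jc] := Jlaw `|c|%N; rewrite /limit_pmf.
    have -> : W c @^-1` [set y%:Z] = J `|c|%N @^-1` [set y].
      by apply/seteqP; split=> w; rewrite /W /=; lia.
    rewrite Jc /= /J_pmf; case: c c0' {Jc} => // n _.
    rewrite -PoszD /= addnC; field.
    by rewrite !gt_eqF ?qprod_gt0 // exprn_gt0 // (lt_le_trans _ q2).
  have [_ Jc] := Jlaw `|c|%N; rewrite /limit_pmf.
  (* For [c < 0] the event is that [J] equals [u = c + y]; [limit_pmf] is symmetric in [y] and [u],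
     which exchange roles with respect to the case [0 <= c]. *)
  case cy : (c + y%:Z) => [u|u].
    have -> : W c @^-1` [set y%:Z] = J `|c|%N @^-1` [set u].
      by apply/seteqP; split=> w; rewrite /W /=; lia.
    rewrite Jc /= /J_pmf (_ : u + `|c|%N = y)%N; last by lia.
    rewrite mulnC; field.
    by rewrite !gt_eqF ?qprod_gt0 // exprn_gt0 // (lt_le_trans _ q2).
  rewrite (_ : _ @^-1` _ = set0) ?measure0 //.
  by apply/seteqP; split=> w //; rewrite /W /=; lia.
have W_ge0 c w : 0 <= W c w by rewrite /W; lia.
apply: (cvg_in_distribution_int (X := fun n w => (betti (r n) (t n) w)%:Z)
  (Y := fun w => W (g (XY w)) w)) => //.
  by move=> n; exact: (discrete_rv_comp Posz (discrete_betti _ _)).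
case=> [y|y]; last first.
  rewrite (_ : _ @^-1` _ = set0); last first.
    by apply/seteqP; split=> w //= E; have := W_ge0 (g (XY w)) w; rewrite E.
  rewrite measure0; under eq_fun => n.
    rewrite (_ : _ @^-1` _ = set0); last first.
      by apply/seteqP; split=> w.
    rewrite measure0; over.
  exact: cvg_cst.
apply: (cvg_betti_point (z := fun=> Posz y) (h := fun s => limit_pmf q (g s) y)).
  move=> l ul; split.
    under eq_bigr do rewrite -W_pmf.
    exact: mixture_le.
  rewrite (eq_bigr (fun s => fine (P' (XY @^-1` [set s])) *
      fine (P' (W (g s) @^-1` (~` [set Posz y]))))); last first.
    move=> s _; rewrite -W_pmf -preimage_setC fine_probC //; exact: mW.
  rewrite -fine_probC; last exact: mV.
  rewrite preimage_setC.
  exact: mixture_le.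
move=> s; apply: irho_cvg_limit => //.
  by move=> n; rewrite bE /g; ring.
by move=> A; apply: filterS (aoo (A - s.1)) => n; lia.
Qed.
End Limit.
(** Averaging [rho0_lower] over both coranks factors the bound into [E q^m - 1], which is at most
    [r], times [E q^(- k)], which is at most [(c * t)^-1]. *)
Lemma prob_betti_neq0 (r t : nat) : (0 < t)%N ->
  1 - fine (P [set w | betti r t w = 0%N]) <= (q^-1 * (1 - q^-1))^-1 * (r%:R / t%:R).
Proof.
move=> t0; have q0 : 0 < q by exact: card_field_gt0R.
have qV0 : 0 < q^-1 by rewrite invr_gt0.
have qV1 : q^-1 < 1 by rewrite invf_lt1 // (lt_le_trans _ q2) // ltr1n.
set c := q^-1 * (1 - q^-1); have c0 : 0 < c by rewrite mulr_gt0 // subr_gt0.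
have := prob_betti_int r t 0.
rewrite (_ : [set w | _] = [set w | betti r t w = 0%N]) => [->|]; last first.
  by apply/seteqP; split=> w /=; lia.
pose y := corank_mean q t (fun k => q ^- k).
have yE : y <= (c * t%:R)^-1.
  have := corank_mean_expV q2 t; rewrite -/y -/c => h.
  have ct : 0 < c * t%:R by rewrite mulr_gt0 // ltr0n.
  rewrite -[leRHS]mul1r ler_pdivlMr //; apply: le_trans h.
  rewrite ler_wpM2l //; last by rewrite mulrC; lra.
  by rewrite -(corank_mean_cst q t 0); apply: le_corank_mean => // m; exact: qV_ge0.
apply: (@le_trans _ _ (corank_mean q r (fun m => y * q ^+ m + (- y) * 1))).
  rewrite -corank_mean1B; apply: le_corank_mean => // m; rewrite -corank_mean1B.
  rewrite (_ : y * q ^+ m + - y * 1 = (q ^+ m - 1) * y + 0 * 0); last by ring.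
  rewrite -[X in 0 * X](corank_mean_cst q t 0) -corank_meanZD.
  apply: le_corank_mean => // k; rewrite mul0r addr0; exact: rho0_lower.
rewrite corank_meanZD corank_mean_cst corank_mean_exp //.
have rV : r%:R * (1 - q^-1) <= r%:R by rewrite ler_piMr // gerBl ltW.
have y0 : 0 <= y.
  by rewrite -(corank_mean_cst q t 0); apply: le_corank_mean => // m; exact: qV_ge0.
have -> : y * (1 + r%:R * (1 - q^-1)) + - y * 1 = y * (r%:R * (1 - q^-1)) by ring.
apply: le_trans (ler_wpM2l y0 rV) _.
apply: le_trans (ler_wpM2r (ler0n _ r) yE) _.
by rewrite invfM -mulrA [_^-1 * r%:R]mulrC.
Qed.

End BettiLimits.

(** * Logarithms of integer sequences *)

Section LogAsymptotics.
Variables (R : realType) (q : R).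
Hypothesis q1 : 1 < q.

Let lnq0 : 0 < ln q. Proof. exact: ln_gt0. Qed.

Lemma logb_ge0 (n : nat) : 0 <= logb q n%:R.
Proof.
rewrite /logb divr_ge0 ?(ltW lnq0) //; case: n => [|n]; first by rewrite ln0.
by rewrite ln_ge0 // ler1n.
Qed.

Lemma cvgn_infty_logb (t : nat -> nat) :
  (forall A : R, \forall n \near \oo, A <= logb q (t n)%:R) -> t @ \oo --> \oo.
Proof.
move=> tA; apply/cvgnyPge => A.
(* With [A.+1] the threshold is positive whenever [t n < A], so it exceeds the default value
   [logb q 0 = 0] when [t n = 0]. *)
apply: filterS (tA (logb q A.+1%:R)) => n; rewrite leqNgt; apply: contraTN => tn.
rewrite -ltNge /logb ltr_pM2r ?invr_gt0 //.
case E : (t n) tn => [|m] mA.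
  by rewrite ln0 // ln_gt0 // ltr1n; case: A mA.
by rewrite ltr_ln ?posrE ?ltr0n // ltr_nat ltnW.
Qed.

End LogAsymptotics.

Theorem theorem4 (R : realType) (F : finFieldType)
    (d : measure_display) (T : measurableType d) (P : probability T R)
    (L : nat -> nat -> T -> F) (hL : uniform_lower_triangular P L)
    (r t : nat -> nat) (zeta : R) :
  let q : R := #|F|%:R in
  let beta (n : nat) (w : T) : nat :=
    persistent_betti (fun i j => L i j w) (r n) (r n + t n) in
  let log (m : nat) : R := logb q m%:R in
  (forall n, (0 < r n)%N) ->
  r @ \oo --> \oo ->
  frac_part (- log (r n)) @[n --> \oo] --> zeta ->
  [/\
    forall (t0 : nat) (d' : measure_display) (T' : measurableType d')
        (P' : probability T' R) (calL : T' -> int) (D : T' -> nat),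
      (forall n, t n = t0) ->
      has_calL_law q (q `^ (- 1 - zeta)) P' calL ->
      discrete_rv D ->
      (forall A : set nat, P' (D @^-1` A) =
         P [set w | A (dim_ker_corner (fun i j => L i j w) t0)]) ->
      independent_rv P' D calL ->
      cvg_in_distribution
        P (fun n w => (beta n w)%:R - (nearest_int (log (r n) + zeta))%:~R)
        P' (fun w => (calL w)%:~R - (D w)%:R),

    forall (zeta' : R) (d' : measure_display) (T' : measurableType d')
        (P' : probability T' R) (calL calL' : T' -> int),
      t @ \oo --> \oo ->
      log (t n) - log (r n) @[n --> \oo] --> -oo ->
      frac_part (- log (t n)) @[n --> \oo] --> zeta' ->
      has_calL_law q (q `^ (- 1 - zeta)) P' calL ->
      has_calL_law q (q `^ (- 1 - zeta')) P' calL' ->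
      independent_rv P' calL' calL ->
      cvg_in_distribution
        P (fun n w => (beta n w)%:R -
             (nearest_int (log (r n) + zeta) - nearest_int (log (t n) + zeta'))%:~R)
        P' (fun w => (calL w)%:~R - (calL' w)%:~R),

    forall (gamma : R) (d' : measure_display) (T' : measurableType d')
        (P' : probability T' R) (calL calL' : T' -> int),
      let zeta' := frac_part (zeta - gamma) in
      log (t n) - log (r n) @[n --> \oo] --> gamma ->
      has_calL_law q (q `^ (- 1 - zeta)) P' calL ->
      has_calL_law q (q `^ (- 1 - zeta')) P' calL' ->
      independent_rv P' calL' calL ->
      exists calJ : T' -> int,
        (forall w, (calJ w)%:~R =
           gamma + zeta' - zeta + (calL' w)%:~R - (calL w)%:~R) /\
        forall J : nat -> T' -> nat,
          (forall u, has_J_law q u P' (J u)) ->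
          (forall u, independent_rv P' (J u) calJ) ->
          cvg_in_distribution
            P (fun n w => (beta n w)%:R)
            P' (fun w => (Num.max 0 (- calJ w) + (J `|calJ w|%N w)%:Z)%:~R) &

    log (t n) - log (r n) @[n --> \oo] --> +oo ->
    P [set w | beta n w = 0%N] @[n --> \oo] --> 1%E ].

Proof.
move=> q beta log r0 roo fz.
have q2 : 2 <= q by rewrite /q ler_nat card_field_gt1.
have q1 : 1 < q by rewrite (lt_le_trans _ q2) // ltr1n.
have lnq0 : 0 < ln q by exact: ln_gt0.
pose a n := nearest_int (log (r n) + zeta).
have az : (a n)%:~R - log (r n) @[n --> \oo] --> zeta.
  exact: (nearest_int_cvg (l := fun n => log (r n))).
have aoo A : \forall n \near \oo, A <= a n by exact: (int_cvg_ge q2 A roo az).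
have calLP (d' : measure_display) (T' : measurableType d') (P' : probability T' R)
    (X : T' -> int) (u : nat -> nat) (c : nat -> int) (z : R) :
    u @ \oo --> \oo -> (c n)%:~R - log (u n) @[n --> \oo] --> z ->
    has_calL_law q (q `^ (- 1 - z)) P' X -> forall i,
    imass q (u n) (c n + i) @[n --> \oo] --> fine (P' (X @^-1` [set i])).
  move=> uoo cz [_ XE] i; rewrite XE /=.
  by apply: imass_cvg => //; exact: cvgn_infty_ge.
split.
- move=> t0 d' T' P' calL D tt0 calLl mD DE indD.
  have [mL _] := calLl.
  have mD' : discrete_rv (fun w => Posz (D w)) by exact: discrete_rv_comp.
  have ind : independent_rv P' (fun w => Posz (D w)) calL.
    by move=> A B; exact: (indD [set k | A (Posz k)] B).
  (* The corank of [L_t] has a fixed law here, so the second coordinate is not shifted: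
     [b n = 0]. *)
  have cvgD j : imass q (t n) (0 + j) @[n --> \oo] -->
      fine (P' ((fun w => Posz (D w)) @^-1` [set j])).
    rewrite (_ : fine _ = imass q t0 (0 + j)).
      by under eq_fun do rewrite tt0; exact: cvg_cst.
    rewrite add0r; case: j => [k|k].
      rewrite (_ : _ @^-1` _ = D @^-1` [set k]).
        by rewrite DE (prob_dim_ker hL).
      by apply/seteqP; split=> w /= => [[]|->].
    by rewrite (_ : _ @^-1` _ = set0) ?measure0 //; apply/seteqP; split.
  have := betti_cvg_difference hL mL mD' ind (calLP _ _ _ _ _ _ _ roo az calLl) cvgD.
  have -> : (fun n w => (betti L (r n) (t n) w)%:R - (a n - 0)%:~R : R) =
    (fun n w => (beta n w)%:R - (nearest_int (log (r n) + zeta))%:~R).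
    by apply/funext => n; apply/funext => w; rewrite subr0.
  by apply => A; apply: filterS (aoo A) => n; rewrite subr0.
- move=> zeta' d' T' P' calL calL' too tr fz' Ll Ll' ind.
  pose b n := nearest_int (log (t n) + zeta').
  have bz : (b n)%:~R - log (t n) @[n --> \oo] --> zeta'.
    exact: (nearest_int_cvg (l := fun n => log (t n))).
  have [mL _] := Ll; have [mL' _] := Ll'.
  apply: (betti_cvg_difference hL mL mL' ind (calLP _ _ _ _ _ _ _ roo az Ll)
    (calLP _ _ _ _ _ _ _ too bz Ll')) => A.
  move/cvgrPdist_lt : az => /(_ _ ltr01) az.
  move/cvgrPdist_lt : bz => /(_ _ ltr01) bz.
  (* The 2 absorbs the two errors, each less than 1, in [az] and [bz]. *)
  move/cvgrNyPle : tr => /(_ (zeta - zeta' - 2 - A%:~R)) tr.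
  near=> n.
  have h1 : `|zeta - ((a n)%:~R - log (r n))| < 1 by near: n.
  have h2 : `|zeta' - ((b n)%:~R - log (t n))| < 1 by near: n.
  have h3 : log (t n) - log (r n) <= zeta - zeta' - 2 - A%:~R by near: n.
  move: h1 h2; rewrite !ltr_norml => /andP[? ?] /andP[? ?].
  by rewrite -(@ler_int R) rmorphB /=; lra.
- move=> gamma d' T' P' calL calL' zeta' tg Ll Ll' ind.
  pose c0 := - Num.floor (zeta - gamma).
  have c0E : c0%:~R = gamma + zeta' - zeta :> R.
    by rewrite /c0 /zeta' /frac_part rmorphN /=; ring.
  exists (fun w => c0 + calL' w - calL w); split.
    by move=> w; rewrite -c0E rmorphB rmorphD.
  move=> J JL Jind.
  have tlog A : \forall n \near \oo, A <= log (t n).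
    pose K := `|Num.ceil (A - gamma + 1)|%N.
    move/cvgrPdist_lt : tg => /(_ _ ltr01) tg.
    have rK := logb_cvg_infty q2 K roo.
    near=> n.
    have h1 : `|gamma - (log (t n) - log (r n))| < 1 by near: n.
    have h2 : K%:R <= log (r n) by near: n.
    have h3 : A - gamma + 1 <= K%:R :> R.
      rewrite (le_trans (ceil_ge _)) // /K -[leRHS]/((`|_|%N : int)%:~R).
      by rewrite ler_int abszE ler_norm.
    by move: h1; rewrite ltr_norml => /andP[? ?]; lra.
  have too := cvgn_infty_logb q1 tlog.
  (* Rounding [log (t n)] would not do: if [zeta' = 0], the fractional parts of [- log (t n)] may
     oscillate between 0 and 1. Shifting [a n] also keeps [b n - a n] constant, as
     [betti_cvg_mixture] requires. *)
  pose b n := a n + c0.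
  have bz : (b n)%:~R - log (t n) @[n --> \oo] --> zeta'.
    have -> : (fun n => (b n)%:~R - log (t n)) = fun n =>
        ((a n)%:~R - log (r n)) - (log (t n) - log (r n)) + c0%:~R.
      by apply/funext => n; rewrite /b rmorphD /=; ring.
    have -> : zeta' = zeta - gamma + c0%:~R by rewrite c0E; ring.
    by apply: cvgD; [exact: cvgB|exact: cvg_cst].
  have [mL _] := Ll; have [mL' _] := Ll'.
  exact: (betti_cvg_mixture hL mL mL' ind (calLP _ _ _ _ _ _ _ roo az Ll)
    (calLP _ _ _ _ _ _ _ too bz Ll') (c0 := c0)).
- move=> tr.
  have mE n : measurable [set w | beta n w = 0%N].
    exact: (discrete_betti hL (r n) (t n) [set 0%N]).
  apply/fine_cvgP; split; first by apply: nearW => n; rewrite fin_num_measure.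
  set c := (q^-1 * (1 - q^-1))^-1.
  have c0 : 0 < c.
    have q0 : 0 < q by exact: lt_trans q1.
    by rewrite invr_gt0 mulr_gt0 ?invr_gt0 // subr_gt0 invf_lt1.
  apply/cvgrPdist_lt => e e0.
  have [K KE] : exists K, c * q ^- K < e.
    have : c * q ^- n @[n --> \oo] --> (c * 0 : R).
      by apply: cvgMl_tmp; apply: qV_cvg0 => //; exact: cvg_id.
    rewrite mulr0 => /cvgrPdist_lt/(_ _ e0)[K _ /(_ K (leqnn K))].
    rewrite /= sub0r normrN ger0_norm => [|]; first by exists K.
    by rewrite mulr_ge0 ?(ltW c0) // qV_ge0.
  move/cvgryPge : tr => /(_ K.+1%:R); apply: filterS => n hn.
  (* If [t n = 0], the default [logb q 0 = 0] makes the difference of logarithms nonpositive,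
     contradicting [hn]. *)
  have tn : (0 < t n)%N.
    rewrite lt0n; apply: contraTneq hn => ->.
    rewrite -ltNge /log {1}/logb ln0 // mul0r sub0r.
    by rewrite (@le_lt_trans _ _ 0) ?oppr_le0 ?logb_ge0.
  have := prob_betti_neq0 hL (r n) tn; rewrite -/c => h.
  rewrite ger0_norm; last first.
    by rewrite subr_ge0 -lee_fin prob_fineK // probability_le1.
  apply: le_lt_trans h _; apply: le_lt_trans KE.
  rewrite ler_pM2l // -(powR_logb q2 (r0 n)) -(powR_logb q2 tn) -powRN -powRqD //.
  rewrite -powR_mulrn ?(ltW (lt_trans ltr01 q1)) // -powRN ler_powR ?(ltW q1) //.
  by move: hn; rewrite -natr1 /log; lra.
Unshelve. all: by end_near. Qed.
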